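(* Let $r \ge 3$. There exists $t_0 = t_0(r)$ such that for every integer $t \ge t_0$ and every integer $m$ with $\binom{t-1}{r} \le m \le \binom{t}{r} - \binom{t-2}{r-2}$, every $r$-graph $G$ with $m$ edges satisfies \[ \lambda(G) \le \lambda(\mathcal{C}(m,r)). \]
   Context: An $r$-graph is a finite family $G$ of $r$-element subsets of $\mathbb{N}=\{1,2,\dots\}$ (its edges). A weighting of $\mathbb{N}$ is a function $w:\mathbb{N}\to[0,\infty)$ with $\sum_{x}w(x)=1$; for a set $e$ put $w(e)=\prod_{x\in e}w(x)$ and $w(G)=\sum_{e\in G}w(e)$. The Lagrangian of $G$ is $\lambda(G)=\max\{w(G): w \text{ a weighting of } \mathbb{N}\}$. The colexicographic (colex) order on $\mathbb{N}^{(r)}$ (the $r$-subsets of $\mathbb{N}$) is given by $A<B$ iff $\sum_{i\in A}2^i<\sum_{i\in B}2^i$; $\mathcal{C}(m,r)$ denotes the $r$-graph consisting of the first $m$ sets of $\mathbb{N}^{(r)}$ in colex order. *)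

(* Defs.v *)
From HB Require Import structures.
From mathcomp Require Import all_boot all_order all_algebra.
From mathcomp Require Import finmap.
From mathcomp Require Import all_classical all_reals all_analysis.
Set Implicit Arguments. Unset Strict Implicit. Unset Printing Implicit Defensive.
Import Order.TTheory GRing.Theory Num.Theory numFieldNormedType.Exports.
Local Open Scope fset_scope.
Local Open Scope ring_scope.

(* Vertices: the natural numbers N = {1,2,...} are identified with nat
   = {0,1,...} via the shift i |-> i-1 (this preserves the colex order). *)

Definition is_rgraph (r : nat) (G : {fset {fset nat}}) : Prop :=
  forall e, e \in G -> #|` e| = r.

Definition weighting (R : realType) (w : nat -> R) : Prop :=
  (forall x, 0 <= w x) /\
  ((fun n : nat => \sum_(0 <= k < n) w k) @ \oo --> (1 : R))%classic.

Definition wedge (R : realType) (w : nat -> R) (e : {fset nat}) : R :=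
  \prod_(x <- e) w x.
Definition wgraph (R : realType) (w : nat -> R) (G : {fset {fset nat}}) : R :=
  \sum_(e <- G) wedge w e.

(* The Lagrangian lambda(G) = max (here: sup, which is attained) of w(G). *)
Definition lagrangian (R : realType) (G : {fset {fset nat}}) : R :=
  sup [set wgraph w G | w in [set w : nat -> R | weighting w]]%classic.

(* colex code: A < B in colex iff colex_code A < colex_code B. *)
Definition colex_code (A : {fset nat}) : nat := (\sum_(i <- A) 2 ^ i)%N.

Definition rsets (n r : nat) : {fset {fset nat}} :=
  [fset A in fpowerset [fset x | x in iota 0 n] | #|` A| == r].

(* C(m,r): the first m r-subsets of nat in colex order.  All of them lie in
   {0,...,m+r-1} (the m-th r-set in colex order has maximum <= m+r-2), and all
   colex-predecessors of a set A lie in {0,...,max A}, so it suffices to work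
   inside rsets (m+r) r. *)
Definition colex (m r : nat) : {fset {fset nat}} :=
  [fset A in rsets (m + r) r |
     (#|` [fset B in rsets (m + r) r | colex_code B < colex_code A]| < m)%N].

(* Main.v *)
(* Put n = t - 1.  The complete r-graph on n vertices lies inside C(m,r), so the
   uniform weighting gives lambda(C(m,r)) >= C(n,r) / n^r, and it suffices to show
   w(G) <= C(n,r) / n^r for every weighting w and every r-graph G with at most
   C(n,r) + C(n-1,r-1) edges.  We scale weights by n and argue by induction on the
   size of the support A of the weighting x (so that sum x = n).

   Deleting a vertex v and rescaling shows that in a minimal counterexample the link
   of v has weight almost n^(r-1) / (r-1)!.  Hence the weights are bounded, the second
   moment of x is n + O(1), every degree is n^(r-1) / (r-1)! - O(n^(r-2)), and
   #|A| = n + O(1).  If #|A| >= n + 2 there are of order n^(r-1) missing edges, most of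
   them avoiding the O(1) vertices of weight < 1/2, and this loses too much weight.
   If #|A| <= n, expanding the elementary symmetric function around the uniform point
   gives the bound.

   If #|A| = n + 1, merge the two lightest vertices b <= a into one vertex, which turns
   the edges not containing {a,b} into a weighting y = 1 + eta of n points with
   e_r(y) <= C(n,r) - (1/2 - o(1)) C(n-1,r-2) Q, where Q = sum eta^2.  The edges Z of G
   containing {a,b} are at most as many as the missing edges Y not containing {a,b}, and
   the gain w(Z) - w(Y) is compared with the loss of order Q: directly when Q is bounded
   below, and by a second-order computation when Q is small. *)

From mathcomp Require Import all_boot all_order all_algebra.
From mathcomp Require Import ring lra zify.
Set Implicit Arguments. Unset Strict Implicit. Unset Printing Implicit Defensive.
Import Order.TTheory GRing.Theory Num.Theory.
Local Open Scope ring_scope.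

(** * Elementary symmetric functions *)

Section ElementarySymmetric.
Variables (R : realFieldType) (T : finType).
Implicit Types (x f : T -> R) (A e : {set T}) (j k : nat).

Definition mon x e : R := \prod_(i in e) x i.
Definition elsym x A j : R :=
  \sum_(e : {set T} | (e \subset A) && (#|e| == j)) mon x e.
Definition psum x A k : R := \sum_(i in A) x i ^+ k.

Lemma mon_ge0 x e : (forall i, 0 <= x i) -> 0 <= mon x e.
Proof. by move=> x0; apply: prodr_ge0. Qed.

Lemma mon_setD1 x e v : v \in e -> mon x e = x v * mon x (e :\ v).
Proof. by move=> ve; rewrite /mon (big_setD1 v). Qed.

Lemma mon_setU1 x e v : v \notin e -> mon x (v |: e) = x v * mon x e.
Proof. by move=> ve; rewrite /mon big_setU1. Qed.

Lemma elsym0 x A : elsym x A 0 = 1.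
Proof.
rewrite /elsym (big_pred1 set0) ?/mon ?big_set0 // => e.
rewrite cards_eq0 andbC /=; case: (eqVneq e set0) => //= ->.
exact: sub0set.
Qed.

Lemma sum_sets_with (F : {set T} -> R) A v j : v \in A ->
  \sum_(e : {set T} | [&& e \subset A, #|e| == j.+1 & v \in e]) F e =
  \sum_(e : {set T} | (e \subset A :\ v) && (#|e| == j)) F (v |: e).
Proof.
move=> vA.
rewrite (reindex_onto (fun e => v |: e) (fun e => e :\ v)) /=; last first.
  by move=> e /and3P[_ _ ve]; rewrite setD1K.
apply: eq_bigl => e; rewrite setU11 andbT subUset sub1set vA /=.
case: (boolP (v \in e)) => ve; last first.
  rewrite setU1K // eqxx andbT cardsU1 ve subsetD1 ve andbT.
  by rewrite add1n eqSS.
rewrite subsetD1 ve andbF /=; apply/negbTE/negP => /andP[_ /eqP E].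
by move: (setD11 v (v |: e)); rewrite E ve.
Qed.

Lemma elsym_rec x A v j : v \in A ->
  elsym x A j.+1 = elsym x (A :\ v) j.+1 + x v * elsym x (A :\ v) j.
Proof.
move=> vA; rewrite {1}/elsym (bigID (fun e : {set T} => v \in e)) /= addrC.
congr (_ + _).
  by apply: eq_bigl => e; rewrite subsetD1 -!andbA [(_ == _) && _]andbC.
under eq_bigl do rewrite -andbA.
rewrite sum_sets_with // /elsym mulr_sumr; apply: eq_bigr => e /andP[eA _].
by rewrite mon_setU1 //; move: eA; rewrite subsetD1 => /andP[].
Qed.

Lemma elsym_sum x A j :
  j.+1%:R * elsym x A j.+1 = \sum_(v in A) x v * elsym x (A :\ v) j.
Proof.
have -> : j.+1%:R * elsym x A j.+1 =
  \sum_(e : {set T} | (e \subset A) && (#|e| == j.+1)) \sum_(v in A | v \in e) mon x e.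
  rewrite /elsym mulr_sumr; apply: eq_bigr => e /andP[/subsetP eA /eqP ej].
  rewrite (eq_bigl (fun v => v \in e)); last first.
    by move=> v /=; case: (boolP (v \in e)) => [/eA ->|]; rewrite ?andbF.
  by rewrite sumr_const ej mulr_natl.
rewrite (exchange_big_dep (fun v => v \in A)) /=; last by move=> ? ? _ /andP[].
apply: eq_bigr => v vA.
under eq_bigl do rewrite vA /= -andbA.
rewrite sum_sets_with // /elsym mulr_sumr; apply: eq_bigr => e /andP[eA _].
by rewrite mon_setU1 //; move: eA; rewrite subsetD1 => /andP[].
Qed.

Lemma elsym1 x A : elsym x A 1 = \sum_(v in A) x v.
Proof.
have := elsym_sum x A 0; rewrite mul1r => ->.
by apply: eq_bigr => v _; rewrite elsym0 mulr1.
Qed.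

(** For i >= 2 this is the monomial symmetric function of the partition (i, 1^j), and for i = 1 it
    is j + 1 times [elsym x A j.+1]. Iterating [nsum_rec] yields Newton's identities. *)
Definition nsum x A i j : R := \sum_(v in A) x v ^+ i * elsym x (A :\ v) j.

Lemma nsum0 x A i : nsum x A i 0 = psum x A i.
Proof. by apply: eq_bigr => v _; rewrite elsym0 mulr1. Qed.

Lemma nsum_rec x A i j :
  nsum x A i j.+1 = psum x A i * elsym x A j.+1 - nsum x A i.+1 j.
Proof.
rewrite /nsum /psum mulr_suml -sumrB; apply: eq_bigr => v vA.
by rewrite (elsym_rec x j vA) exprSr; ring.
Qed.

Lemma elsym_nsum x A j : j.+1%:R * elsym x A j.+1 = nsum x A 1 j.
Proof. by rewrite elsym_sum; apply: eq_bigr => v _; rewrite expr1. Qed.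

Lemma elsym_le_exp x A j : (forall i, 0 <= x i) ->
  j`!%:R * elsym x A j <= (\sum_(v in A) x v) ^+ j.
Proof.
move=> x0; elim: j A => [|j IH] A; first by rewrite elsym0 expr0 fact0 mulr1.
rewrite factS mulnC natrM -mulrA elsym_sum mulr_sumr exprS.
rewrite mulr_suml; apply: ler_sum => v vA.
rewrite mulrCA; apply: ler_wpM2l => //.
apply: le_trans (IH _) _; apply: lerXn2r; rewrite ?nnegrE ?sumr_ge0 //.
by rewrite (big_setD1 v vA) /= lerDr.
Qed.

(** Pick the j vertices one after another: those already picked remove at most j K from the
    available weight, so every choice ranges over total weight at least the full sum minus j K. *)
Lemma elsym_ge_exp x A j (K : R) : 0 <= K -> (forall i, 0 <= x i) ->
  (forall i, x i <= K) -> j%:R * K <= \sum_(v in A) x v ->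
  ((\sum_(v in A) x v) - j%:R * K) ^+ j <= j`!%:R * elsym x A j.
Proof.
move=> K0 x0 xK; elim: j A => [|j IH] A hj; first by rewrite elsym0 expr0 fact0 mulr1.
rewrite factS mulnC natrM -mulrA elsym_sum mulr_sumr.
set s := \sum_(v in A) x v in hj *.
have s0 : 0 <= s by apply: sumr_ge0.
have sub0 : 0 <= s - j.+1%:R * K by rewrite subr_ge0.
apply: (@le_trans _ _ (s * (s - j.+1%:R * K) ^+ j)).
  rewrite exprSr mulrC; apply: ler_wpM2r; first exact: exprn_ge0.
  by rewrite gerBl mulr_ge0.
rewrite /s mulr_suml; apply: ler_sum => v vA.
rewrite mulrCA; apply: ler_wpM2l => //.
have E : \sum_(i in A :\ v) x i = s - x v by rewrite /s (big_setD1 v vA) /=; ring.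
have xvK := xK v.
have hj' : j%:R * K <= \sum_(i in A :\ v) x i.
  by rewrite E; move: hj; rewrite -natr1; lra.
apply: le_trans (IH _ hj'); apply: lerXn2r; rewrite ?nnegrE ?subr_ge0 //.
by rewrite E -/s -natr1; lra.
Qed.

Lemma psum_bound x A i (Q rho : R) : 0 <= rho -> psum x A 2 = Q -> Q <= rho ^+ 2 ->
  `|psum x A i.+2| <= Q * rho ^+ i.
Proof.
move=> r0 <- Qr; rewrite /psum mulr_suml.
apply: le_trans (ler_norm_sum _ _ _) _; apply: ler_sum => v vA.
have h : `|x v| <= rho.
  rewrite -(ler_pXn2r (n:=2)) ?nnegrE // -normrX ger0_norm ?sqr_ge0 //.
  apply: le_trans Qr; rewrite /psum (big_setD1 v vA) /= lerDl sumr_ge0 // => ? _.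
  exact: sqr_ge0.
rewrite -addn2 exprD normrM [`|x v ^+ 2|]ger0_norm ?sqr_ge0 // mulrC.
apply: ler_wpM2l; first exact: sqr_ge0.
by rewrite normrX; apply: lerXn2r; rewrite ?nnegrE.
Qed.

(* For centred variables Newton's identities have no first power sum. *)
Lemma elsym_centred_bound x A (Q rho : R) k : 0 <= rho ->
  \sum_(v in A) x v = 0 -> psum x A 2 = Q -> Q <= rho ^+ 2 ->
  `|elsym x A k.+2| <= Q * rho ^+ k.
Proof.
move=> r0 x1 x2 Qr.
have Q0 : 0 <= Q by rewrite -x2; apply: sumr_ge0 => ? _; exact: sqr_ge0.
have p1 : psum x A 1 = 0 by rewrite -x1; apply: eq_bigr => v _; rewrite expr1.
elim/ltn_ind: k => k IH.
(* Each unfolding of [nsum_rec] contributes one product p_(i+2) e_(j+1). It vanishes for j = 0, and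
   otherwise is at most Q rho^i times Q rho^(j-1), where Q <= rho^2 absorbs the second Q. The factor
   j + 1 counts these terms and is later cancelled by k + 2 >= k + 1. *)
have nb j i : (j <= k)%N -> `|nsum x A i.+2 j| <= j.+1%:R * (Q * rho ^+ (i + j)).
  elim: j i => [|j IHj] i jk.
    by rewrite nsum0 mul1r addn0; apply: psum_bound.
  rewrite nsum_rec; apply: le_trans (ler_normB _ _) _.
  rewrite -[j.+2%:R]natr1 mulrDl mul1r addrC.
  apply: lerD.
    have := IHj i.+1 (ltnW jk); rewrite addSnnS => h.
    by apply: h.
  case: j jk {IHj} => [_|j jk].
    rewrite elsym1 x1 mulr0 normr0 mulr_ge0 ?exprn_ge0 //.
  rewrite normrM; apply: (@le_trans _ _ ((Q * rho ^+ i) * (Q * rho ^+ j))).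
    apply: ler_pM => //; first exact: psum_bound.
    by apply: IH; lia.
  rewrite -mulrA; apply: ler_wpM2l => //.
  rewrite [rho ^+ i * _]mulrC -mulrA -exprD.
  have -> : (i + j.+2 = 2 + (j + i))%N by lia.
  rewrite [leRHS]exprD; apply: ler_wpM2r => //; exact: exprn_ge0.
have := elsym_nsum x A k.+1; rewrite nsum_rec p1 mul0r sub0r => E.
have := nb k 0%N (leqnn k); rewrite add0n -normrN -E normrM.
have k0 : 0 < k.+1%:R :> R by rewrite ltr0n.
rewrite ger0_norm // => h.
rewrite -(ler_pM2l k0); apply: le_trans h.
by apply: ler_wpM2r => //; rewrite ler_nat.
Qed.

Lemma elsym2_centred x A : \sum_(v in A) x v = 0 ->
  2 * elsym x A 2 = - psum x A 2.
Proof.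
move=> x1; rewrite elsym_nsum nsum_rec nsum0 elsym1 x1; ring.
Qed.

Lemma card_subsets (A U : {set T}) j : U \subset A -> (#|U| <= j)%N ->
  #|[set e : {set T} | [&& e \subset A, #|e| == j & U \subset e]]| =
  'C(#|A| - #|U|, j - #|U|).
Proof.
move=> UA Uj; have <- : #|A :\: U| = (#|A| - #|U|)%N.
  by rewrite cardsD (setIidPr UA).
rewrite -cards_draws -[RHS](card_in_imset (f := fun e : {set T} => e :|: U)).
  apply: eq_card => e; rewrite inE; apply/and3P/imsetP => [[eA /eqP ej Ue]|].
    exists (e :\: U); last by rewrite -{1}(setID e U) (setIidPr Ue) setUC.
    by rewrite inE setSD //= cardsD (setIidPr Ue) ej.
  move=> [f]; rewrite inE subsetD => /andP[/andP[fA fU] /eqP fj] ->.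
  rewrite subUset fA UA subsetUr cardsU (disjoint_setI0 fU) cards0 fj.
  by split=> //; apply/eqP; lia.
move=> e f; rewrite !inE !subsetD => /andP[/andP[_ eU] _] /andP[/andP[_ fU] _].
move=> E; have : (e :|: U) :\: U = (f :|: U) :\: U by rewrite E.
by rewrite !setDUl !setDv !setU0 (setDidPl eU) (setDidPl fU).
Qed.

Lemma exists_between (B e : {set T}) k : B \subset e -> (#|B| <= k <= #|e|)%N ->
  exists p : {set T}, [/\ B \subset p, p \subset e & #|p| = k].
Proof.
move=> Be /andP[Bk ke].
have : (0 < #|[set p : {set T} | [&& p \subset e, #|p| == k & B \subset p]]|)%N.
  by rewrite card_subsets // bin_gt0 leq_sub2r.
by rewrite card_gt0 => /set0Pn[p]; rewrite inE => /and3P[? /eqP ? ?]; exists p.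
Qed.

Lemma prod1D x e : \prod_(i in e) (1 + x i) = \sum_(U : {set T} | U \subset e) mon x U.
Proof.
rewrite big_mkcond /=.
transitivity (\prod_i ((if i \in e then x i else 0) + 1)).
  by apply: eq_bigr => i _; case: ifP; rewrite ?add0r // addrC.
rewrite bigA_distr /= [RHS]big_mkcond /=.
apply: eq_big => [U|U _]; first by rewrite inE.
case: ifP => Ue.
  rewrite /mon [RHS]big_mkcond /=; apply: eq_bigr => i _.
  by case: ifP => // iU; rewrite (subsetP Ue).
move: Ue => /negbT/subsetPn[i iU ie].
by rewrite (bigD1 i) //= iU (negbTE ie) mul0r.
Qed.

(** Expand every product over the subsets U of e, then count the j-subsets of A that contain a given
    U. *)
Lemma elsym_shift x A j :
  elsym (fun i => 1 + x i) A j = \sum_(k < j.+1) 'C(#|A| - k, j - k)%:R * elsym x A k.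
Proof.
rewrite {1}/elsym; under eq_bigr do rewrite /mon prod1D.
rewrite (exchange_big_dep (fun U : {set T} => (U \subset A) && (#|U| < j.+1)%N)) /=; last first.
  move=> e U /andP[eA /eqP ej] Ue; rewrite (subset_trans Ue eA) /= ltnS -ej.
  exact: subset_leq_card.
rewrite (partition_big (fun U : {set T} => inord #|U| : 'I_j.+1) xpredT) //=.
apply: eq_bigr => k _; rewrite mulr_sumr; apply: eq_big => [U|U].
  case: (boolP (U \subset A)) => //= UA; apply/andP/eqP => [[Uj /eqP <-]|->].
    by rewrite inordK.
  by rewrite ltn_ord inord_val.
move=> /andP[/andP[UA Uj] /eqP Uk].
have Ek : #|U| = k by rewrite -Uk inordK.
rewrite -Ek -card_subsets // sumr_const mulr_natl; congr (_ *+ _).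
by apply: eq_card => e; rewrite inE /in_mem /= -andbA.
Qed.

End ElementarySymmetric.

(** * Near-uniform weightings *)

Lemma ffact_le_expn n k : (n ^_ k <= n ^ k)%N.
Proof.
elim: k => [|k IH]; first by rewrite ffactn0.
by rewrite ffactnSr expnSr leq_mul // leq_subr.
Qed.

Lemma bin_le_expn n k : ('C(n, k) <= n ^ k)%N.
Proof.
apply: leq_trans (ffact_le_expn n k); rewrite -bin_ffact.
by rewrite leq_pmulr // fact_gt0.
Qed.

(** The factors of the falling factorial fall short of n by 0, 1, ..., k, and these defects sum to
    ['C(k.+1, 2)]. *)
Lemma expn_le_ffact n k : (n ^ k.+1 <= n ^_ k.+1 + 'C(k.+1, 2) * n ^ k)%N.
Proof.
elim: k => [|k IH]; first by rewrite ffactn1 expn1 leq_addr.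
rewrite ffactnSr expnSr.
have h : (n <= n - k.+1 + k.+1)%N by lia.
apply: leq_trans (leq_mul (leqnn _) h) _.
rewrite mulnDr.
have h1 : (n ^ k.+1 * (n - k.+1) <=
  n ^_ k.+1 * (n - k.+1) + 'C(k.+1, 2) * n ^ k * (n - k.+1))%N.
  by rewrite -mulnDl leq_mul2r IH orbT.
apply: leq_trans (leq_add h1 (leqnn _)) _.
rewrite -addnA leq_add2l.
have h2 : ('C(k.+1, 2) * n ^ k * (n - k.+1) <= 'C(k.+1, 2) * n ^ k.+1)%N.
  by rewrite -mulnA leq_mul2l; apply/orP; right; rewrite expnSr leq_mul2l leq_subr orbT.
apply: leq_trans (leq_add h2 (leqnn _)) _.
rewrite [(n ^ k.+1 * _)%N]mulnC -mulnDl leq_mul2r; apply/orP; right.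
by rewrite [leqRHS]binS bin1.
Qed.

(** The price of replacing a binomial by a power: for n >= 2k each factor n - i of the falling
    factorial is at least n / 2. *)
Definition bin_ratio k := (2 ^ k * k`!)%N.

Lemma expn_le_bin n k : (2 * k <= n)%N -> (n ^ k <= bin_ratio k * 'C(n, k))%N.
Proof.
move=> kn; rewrite /bin_ratio -mulnA [(_`! * _)%N]mulnC bin_ffact.
have aux j : (2 * j <= n)%N -> (n ^ j <= 2 ^ j * n ^_ j)%N.
  elim: j => [|j IH] jn; first by rewrite ffactn0.
  rewrite ffactnSr !expnSr mulnACA; apply: leq_mul; first by apply: IH; lia.
  by lia.
exact: aux.
Qed.

Lemma expnD_le n c k : (c <= n)%N ->
  ((n + c) ^ k.+1 <= n ^ k.+1 + 3 ^ k.+1 * c * n ^ k)%N.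
Proof.
move=> cn; elim: k => [|k IH]; first by rewrite !expn1 expn0; lia.
rewrite expnSr; apply: leq_trans (leq_mul IH (leqnn _)) _.
have h : (3 ^ k.+1 * c * n ^ k * c <= 3 ^ k.+1 * c * n ^ k.+1)%N.
  by rewrite [(n ^ k.+1)%N]expnSr mulnA leq_mul2l cn orbT.
have p : (1 <= 3 ^ k.+1)%N by rewrite expn_gt0.
rewrite [(3 ^ k.+2)%N]expnS [(n ^ k.+2)%N]expnSr.
move: h p; rewrite [(n ^ k.+1)%N]expnSr.
set a := (n ^ k)%N; set b := (3 ^ k.+1)%N; move=> h p.
have : (a * n * c <= b * (a * n * c))%N by rewrite leq_pmull.
have -> : ((a * n + b * c * a) * (n + c) =
  a * n * n + a * n * c + b * (a * n * c) + b * c * a * c)%N by ring.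
have -> : (3 * b * c * (a * n) = b * (a * n * c) + b * (a * n * c) + b * c * (a * n))%N by ring.
lia.
Qed.

Section NearUniform.
Variables (R : realFieldType) (T : finType).
Implicit Types (x f : T -> R) (A e : {set T}) (j k : nat).

Lemma eq_esym x f A j : {in A, x =1 f} -> elsym x A j = elsym f A j.
Proof.
move=> xf; apply: eq_bigr => e /andP[/subsetP eA _]; apply: eq_bigr => i ie.
by rewrite xf // eA.
Qed.

Lemma elsym_near_uniform x A n s (rho : R) : #|A| = n -> 0 <= rho <= n%:R ->
  \sum_(v in A) x v = 0 -> psum x A 2 <= rho ^+ 2 ->
  elsym (fun i => 1 + x i) A s.+3 <= 'C(n, s.+3)%:R
    - psum x A 2 / 2 * 'C(n - 2, s.+1)%:R + s.+1%:R * (n%:R ^+ s * rho * psum x A 2).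
Proof.
move=> An /andP[r0 rn] x1 Qr; rewrite elsym_shift An.
rewrite big_ord_recl big_ord_recl big_ord_recl /= elsym0 elsym1 x1 mulr0 add0r mulr1.
rewrite !subn0 /bump /= !add1n subn2 /=.
have E := elsym2_centred x1; set Q := psum x A 2 in Qr E *.
have -> : elsym x A 2 = - (Q / 2) by lra.
rewrite mulrN addrA [_ * (Q / 2)]mulrC; apply: lerD => //.
have -> : s.+1%:R * (n%:R ^+ s * rho * Q) = \sum_(k < s.+1) (n%:R ^+ s * rho * Q).
  by rewrite sumr_const card_ord mulr_natl.
apply: ler_sum => k _.
have Q0 : 0 <= Q by apply: sumr_ge0 => ? _; exact: sqr_ge0.
rewrite !add1n; have := elsym_centred_bound k.+1 r0 x1 (erefl _) Qr; rewrite -/Q => h.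
apply: le_trans (ler_norm _) _; rewrite normrM normr_nat.
apply: (@le_trans _ _ (n%:R ^+ (s - k) * (Q * rho ^+ k.+1))).
  apply: ler_pM => //.
  have -> : (s.+3 - k.+3 = s - k)%N by lia.
  rewrite -natrX ler_nat; apply: leq_trans (bin_le_expn _ _) _.
  by case: (s - k)%N => // m; rewrite leq_exp2r // leq_subr.
rewrite mulrCA [_ * Q]mulrC; apply: ler_wpM2l => //.
rewrite exprSr mulrA; apply: ler_wpM2r => //.
have -> : n%:R ^+ s = n%:R ^+ (s - k) * n%:R ^+ k :> R.
  by rewrite -exprD subnK // -ltnS.
apply: ler_wpM2l; first exact: exprn_ge0.
by apply: lerXn2r; rewrite ?nnegrE.
Qed.

Lemma psum2_shift x A : 
  psum (fun i => x i - 1) A 2 = psum x A 2 - 2 * (\sum_(i in A) x i) + #|A|%:R.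
Proof.
rewrite /psum mulr_sumr -sumrB -sum1_card natr_sum -big_split /=.
by apply: eq_bigr => i _; ring.
Qed.

Lemma elsym_bounded_le x A n s (K : nat) :
  (K * (2 * s.+1 * bin_ratio s.+1 * 2 ^ s.+1) ^ 2 <= n)%N -> (2 * s.+3 <= n)%N ->
  #|A| = n -> (forall i, 0 <= x i) -> (forall i, x i <= K%:R) ->
  \sum_(v in A) x v = n%:R -> elsym x A s.+3 <= 'C(n, s.+3)%:R.
Proof.
set L := (2 * s.+1 * _ * _)%N => nL ns An x0 xK x1.
have L0 : (0 < L)%N by rewrite /L /bin_ratio !muln_gt0 !expn_gt0 fact_gt0.
have LR : 0 < L%:R :> R by rewrite ltr0n.
pose y i := x i - 1.
have y1 : \sum_(v in A) y v = 0 by rewrite sumrB x1 sumr_const An subrr.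
have -> : elsym x A s.+3 = elsym (fun i => 1 + y i) A s.+3.
  by apply: eq_esym => i _; rewrite /y addrC subrK.
have Q2 : psum y A 2 <= K%:R * n%:R.
  rewrite psum2_shift x1 An.
  apply: (@le_trans _ _ (psum x A 2)); first by have : 0 <= n%:R :> R by []; lra.
  by rewrite -x1 mulr_sumr; apply: ler_sum => i _; rewrite expr2 ler_wpM2r.
have Q0 : 0 <= psum y A 2 by apply: sumr_ge0 => ? _; exact: sqr_ge0.
have nR : 0 <= n%:R :> R by [].
(* The radius n / L is large enough for Q <= K n <= rho^2, and small enough for the terms of order
   three and more to stay below the quadratic loss. *)
apply: le_trans (@elsym_near_uniform y A n s (n%:R / L%:R) An _ y1 _) _.
- rewrite divr_ge0 //= ler_pdivrMr // ler_peMr // ler1n //.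
- apply: le_trans Q2 _; rewrite expr_div_n ler_pdivlMr ?exprn_gt0 //.
  rewrite -mulrA [n%:R * _]mulrC mulrA [n%:R ^+ 2]expr2 ler_wpM2r //.
  by rewrite -natrX -natrM ler_nat.
set Q := psum y A 2 in Q0 *.
have h : s.+1%:R * (n%:R ^+ s.+1) * 2 <= L%:R * 'C(n - 2, s.+1)%:R :> R.
  rewrite -natrX -!natrM ler_nat.
  have := @expn_le_bin (n - 2) s.+1 ltac:(lia) => h.
  have h2 : (n ^ s.+1 <= 2 ^ s.+1 * (n - 2) ^ s.+1)%N.
    by rewrite -expnMn leq_exp2r //; lia.
  rewrite /L; move: h h2; set a := (n ^ s.+1)%N; set b := ((n - 2) ^ _)%N.
  set c := bin_ratio _; set d := 'C(_, _); set g := (2 ^ _)%N => h h2.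
  have h3 : (a <= g * (c * d))%N by apply: leq_trans h2 _; rewrite leq_mul2l h orbT.
  nia.
have -> : n%:R ^+ s * (n%:R / L%:R) * Q = (n%:R ^+ s.+1 / L%:R) * Q :> R.
  by rewrite exprSr; ring.
rewrite -addrA gerDl.
have : s.+1%:R * (n%:R ^+ s.+1 / L%:R) <= 'C(n - 2, s.+1)%:R / 2 :> R.
  by rewrite mulrA ler_pdivrMr // mulrAC ler_pdivlMr // [_ * L%:R]mulrC.
move: (_ / _) => u hu; have := ler_wpM2r Q0 hu; lra.
Qed.

End NearUniform.

(** * Weights and links of families of sets *)

Section Graphs.
Variables (R : realFieldType) (T : finType).
Implicit Types (x f : T -> R) (A e : {set T}) (G H : {set {set T}}) (j k : nat).

Definition draws A j : {set {set T}} := [set e : {set T} | (e \subset A) && (#|e| == j)].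
Definition gwt x G : R := \sum_(e in G) mon x e.
Definition link G v : {set {set T}} := [set e : {set T} | (v \notin e) && (v |: e \in G)].

Lemma elsym_gwt x A j : elsym x A j = gwt x (draws A j).
Proof. by apply: eq_bigl => e; rewrite inE. Qed.

Lemma gwt_ge0 x G : (forall i, 0 <= x i) -> 0 <= gwt x G.
Proof. by move=> x0; apply: sumr_ge0 => e _; apply: mon_ge0. Qed.

Lemma gwt_setD x G H : G \subset H -> gwt x H = gwt x G + gwt x (H :\: G).
Proof. by move=> GH; rewrite /gwt (big_setID G) /= (setIidPr GH). Qed.

Lemma gwt_le x G H : (forall i, 0 <= x i) -> G \subset H -> gwt x G <= gwt x H.
Proof. by move=> x0 GH; rewrite (gwt_setD x GH) lerDl gwt_ge0. Qed.

Lemma gwt_le_card x G (u : R) : (forall e, e \in G -> mon x e <= u) -> gwt x G <= u * #|G|%:R.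
Proof. by move=> h; rewrite mulr_natr -sumr_const; apply: ler_sum. Qed.

Lemma gwt_ge_card x G (u : R) : (forall e, e \in G -> u <= mon x e) -> u * #|G|%:R <= gwt x G.
Proof. by move=> h; rewrite mulr_natr -sumr_const; apply: ler_sum. Qed.

Lemma sum_link (V : nmodType) (F : {set T} -> V) G v :
  \sum_(e in G | v \in e) F e = \sum_(e in link G v) F (v |: e).
Proof.
rewrite (reindex_onto (fun e => v |: e) (fun e => e :\ v)) /=; last first.
  by move=> e /andP[_ ve]; rewrite setD1K.
apply: eq_bigl => e; rewrite setU11 andbT [in RHS]inE.
case: (boolP (v \in e)) => ve; last by rewrite setU1K // eqxx andbT.
apply/negbTE/negP => /andP[_ /eqP E].
by move: (setD11 v (v |: e)); rewrite E ve.
Qed.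

Lemma gwt_link x G v :
  gwt x G = x v * gwt x (link G v) + \sum_(e in G | v \notin e) mon x e.
Proof.
rewrite /gwt (bigID (fun e : {set T} => v \in e)) /= sum_link; congr (_ + _).
by rewrite mulr_sumr; apply: eq_bigr => e; rewrite inE => /andP[ve _]; rewrite mon_setU1.
Qed.

Lemma link_draws A G j v : G \subset draws A j.+1 -> link G v \subset draws (A :\ v) j.
Proof.
move=> /subsetP GA; apply/subsetP => e; rewrite !inE => /andP[ve /GA].
rewrite inE cardsU1 ve add1n eqSS => /andP[/subsetP eA ->]; rewrite andbT subsetD1 ve andbT.
by apply/subsetP => i ie; apply: eA; rewrite inE ie orbT.
Qed.

Lemma sum_card_link A G j : G \subset draws A j ->
  (\sum_(v in A) #|link G v| = j * #|G|)%N.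
Proof.
move=> /subsetP GA; rewrite (eq_bigr (fun v => \sum_(e in G | v \in e) 1)%N); last first.
  by move=> v _; rewrite (sum_link (fun=> 1%N)) sum1_card.
rewrite (exchange_big_dep (fun e => e \in G)) /=; last by move=> ? ? _ /andP[].
rewrite mulnC -sum_nat_const; apply: eq_bigr => e eG.
have := GA _ eG; rewrite inE => /andP[/subsetP eA /eqP <-].
rewrite sum1dep_card; apply: eq_card => v; rewrite inE eG /=.
by apply/andP/idP => [[] //|ve]; rewrite eA.
Qed.

Lemma card_meet G A :
  (#|[set e in G | ~~ [disjoint e & A]]| <= \sum_(v in A) #|link G v|)%N.
Proof.
rewrite -sum1_card (eq_bigr (fun v => \sum_(e in G | v \in e) 1)%N); last first.
  by move=> v _; rewrite (sum_link (fun=> 1%N)) sum1_card.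
rewrite (exchange_big_dep (fun e => e \in G)) /=; last by move=> ? ? _ /andP[].
rewrite big_mkcond [leqRHS]big_mkcond /=; apply: leq_sum => e _; rewrite inE.
case: (boolP (e \in G)) => //= eG.
case: (boolP [disjoint _ & _]) => //= /pred0Pn[v /andP[/= ve vA]].
rewrite (bigD1 v) //=; apply/andP; split; [exact: vA | exact: ve].
Qed.

Lemma card_draws_set A j : #|draws A j| = 'C(#|A|, j).
Proof. exact: cards_draws. Qed.

(** Apply 2 t - 1 <= t^2 to the weight t of each set in the link; the squares add up to at most e_j
    of the squared weights. With a bound on the second moment, a heavy link must therefore contain
    many sets. *)
Lemma gwt_link_sqr x A G j v : G \subset draws A j.+1 -> (forall i, 0 <= x i) ->
  j`!%:R * (2 * gwt x (link G v) - #|link G v|%:R) <= (psum x A 2) ^+ j.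
Proof.
move=> GA x0.
apply: le_trans (elsym_le_exp A j (fun i => sqr_ge0 (x i))).
apply: ler_wpM2l => //; rewrite elsym_gwt.
have sub : link G v \subset draws A j.
  apply: subset_trans (link_draws v GA) _; apply/subsetP => e; rewrite !inE.
  by rewrite subsetD1 -andbA => /and3P[-> _ ->].
apply: le_trans (gwt_le (fun i => sqr_ge0 (x i)) sub).
rewrite /gwt mulr_sumr -sum1_card natr_sum -sumrB; apply: ler_sum => e _.
rewrite /mon prodrXl; have := sqr_ge0 (\prod_(i in e) x i - 1); nra.
Qed.

End Graphs.

(** * Critical weightings *)

Section Critical.
Variables (R : realFieldType) (T : finType).
Implicit Types (x : T -> R) (A e : {set T}) (G H : {set {set T}}) (j k n : nat).

Lemma natr_expn_le_bin n k : n%:R ^+ k.+1 <=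
  k.+1`!%:R * 'C(n, k.+1)%:R + 'C(k.+1, 2)%:R * n%:R ^+ k :> R.
Proof.
rewrite -!natrX -!natrM -natrD ler_nat mulnC bin_ffact.
exact: expn_le_ffact.
Qed.

Lemma expr1B_mul_le1 (u : R) j : 0 <= u <= 1 -> (1 - u) ^+ j * (1 + j%:R * u) <= 1.
Proof.
move=> /andP[u0 u1]; elim: j => [|j IH]; first by rewrite mul0r addr0 mulr1.
apply: le_trans IH; rewrite exprSr -mulrA; apply: ler_wpM2l.
  by rewrite exprn_ge0 // subr_ge0.
rewrite -natr1; have : 0 <= j%:R * u ^+ 2 by rewrite mulr_ge0 ?sqr_ge0.
have := sqr_ge0 u; nra.
Qed.

Lemma bernoulli (a : R) j : 0 <= a <= 1 -> 1 - j%:R * a <= (1 - a) ^+ j.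
Proof.
move=> /andP[a0 a1]; elim: j => [|j IH]; first by rewrite mul0r subr0.
rewrite exprSr -natr1.
have h : (1 - j%:R * a) * (1 - a) <= (1 - a) ^+ j * (1 - a).
  by apply: ler_wpM2r => //; rewrite subr_ge0.
apply: le_trans h; have : 0 <= j%:R * a ^+ 2 by rewrite mulr_ge0 ?sqr_ge0.
nra.
Qed.

(* The last clause is what induction on the support yields: if it fails at v,
   deleting v and rescaling gives a counterexample with smaller support. *)
Record critical n r x A G : Prop := Critical {
  crit_ge0 : forall i, 0 <= x i;
  crit_pos : forall i, i \in A -> 0 < x i;
  crit_out : forall i, i \notin A -> x i = 0;
  crit_sum : \sum_(i in A) x i = n%:R;
  crit_unif : G \subset draws A r;
  crit_gt : 'C(n, r)%:R < gwt x G;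
  crit_link : forall v, v \in A ->
    'C(n, r)%:R * (1 - (1 - x v / n%:R) ^+ r) < x v * gwt x (link G v) }.

Section Bounds.
Variables (n s : nat) (x : T -> R) (A : {set T}) (G : {set {set T}}).
Let r := s.+3.
Hypothesis n_large : (2 * r ^ 2 <= n)%N.
Hypothesis crit : critical n r x A G.

Let n_gt0 : 0 < n%:R :> R.
Proof. by rewrite ltr0n; move: n_large; rewrite /r expnS; lia. Qed.

Lemma crit_le_n v : x v <= n%:R.
Proof.
case: (boolP (v \in A)) => vA; last by rewrite (crit_out crit).
rewrite -(crit_sum crit) (big_setD1 v vA) /= lerDl sumr_ge0 // => i _.
exact: crit_ge0 crit _.
Qed.

(** This is [crit_link] divided by u = x v / n, after 1 - (1 - u)^r is written as u times a
    geometric sum. *)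
Lemma crit_link_sum v : v \in A ->
  'C(n, r)%:R * (\sum_(i < r) (1 - x v / n%:R) ^+ i) < n%:R * gwt x (link G v).
Proof.
move=> vA; have := crit_link crit vA; set u := x v / n%:R.
have u0 : 0 < u by rewrite divr_gt0 // (crit_pos crit).
have -> : x v = n%:R * u by rewrite /u mulrC divfK // gt_eqF.
have -> : 1 - (1 - u) ^+ r = u * \sum_(i < r) (1 - u) ^+ i.
  have := subrX1 (1 - u) r; lra.
move=> h; rewrite -(ltr_pM2l u0) mulrCA; apply: lt_le_trans h _.
by rewrite [n%:R * u]mulrC -mulrA.
Qed.

(** The link of v lives on total weight n - x v, so its weight is at most (n - x v)^(r-1) / (r-1)!.
    Against [crit_link_sum] this gives ['C(n, r)] (r-1)! (r + (r-1) u) < n^r with u = x v / n. Since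
    r! ['C(n, r)] is n^r - O(n^(r-1)), u must be O(1/n). *)
Lemma crit_bounded v : x v <= (r ^ 2)%:R.
Proof.
case: (boolP (v \in A)) => vA; last by rewrite (crit_out crit).
have := crit_link_sum vA; set u := x v / n%:R; set B := gwt _ _.
have xv : x v = n%:R * u by rewrite /u mulrC divfK // gt_eqF.
have u0 : 0 <= u by rewrite divr_ge0 ?(crit_ge0 crit).
have u1 : u <= 1 by rewrite ler_pdivrMr // mul1r crit_le_n.
set j := s.+2.
have BU : j`!%:R * B <= (n%:R * (1 - u)) ^+ j.
  have := elsym_le_exp (A :\ v) j (crit_ge0 crit).
  have -> : \sum_(i in A :\ v) x i = n%:R * (1 - u).
    have := crit_sum crit; rewrite (big_setD1 v vA) /= xv; lra.
  apply: le_trans; apply: ler_wpM2l => //; rewrite elsym_gwt.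
  apply: gwt_le; first exact: crit_ge0 crit.
  exact: link_draws (crit_unif crit).
(* The first summand 1 is at least (1 - u)^j (1 + j u), and each of the other j summands is at least
   (1 - u)^j. *)
have SL : (1 - u) ^+ j * (r%:R + j%:R * u) <= \sum_(i < r) (1 - u) ^+ i.
  rewrite /r big_ord_recl /= expr0 -/j -[X in X%:R + _]add1n natrD.
  have h1 := @expr1B_mul_le1 u j ltac:(by rewrite u0 u1).
  have h2 : (1 - u) ^+ j * j%:R <= \sum_(i < j) (1 - u) ^+ bump 0 i.
    rewrite mulr_natr -[X in _ *+ X]card_ord -sumr_const; apply: ler_sum => i _.
    by apply: ler_wiXn2l; rewrite ?subr_ge0 ?gerBl //= /bump /= add1n.
  move: h1 h2; set q := _ ^+ j; lra.
move=> hB.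
have key : 'C(n, r)%:R * j`!%:R * (r%:R + j%:R * u) < n%:R ^+ r.
  rewrite ltNge; apply/negP => hh.
  have q0 : 0 <= (1 - u) ^+ j by rewrite exprn_ge0 // subr_ge0.
  have := ler_wpM2r q0 hh.
  have f0 : 0 < j`!%:R :> R by rewrite ltr0n fact_gt0.
  have h3 : 'C(n, r)%:R * j`!%:R * ((1 - u) ^+ j * (r%:R + j%:R * u)) <=
            'C(n, r)%:R * j`!%:R * (\sum_(i < r) (1 - u) ^+ i).
    by apply: ler_wpM2l => //; rewrite mulr_ge0.
  have h4 : j`!%:R * ('C(n, r)%:R * (\sum_(i < r) (1 - u) ^+ i)) < j`!%:R * (n%:R * B).
    by rewrite ltr_pM2l.
  have h5 : n%:R * (j`!%:R * B) <= n%:R * (n%:R * (1 - u)) ^+ j by rewrite ler_pM2l.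
  have N3 : n%:R ^+ r = n%:R * n%:R ^+ j :> R by rewrite /r exprS.
  move: h5; rewrite exprMn N3 => h5; lra.
have := natr_expn_le_bin n s.+2; rewrite -/r -/j.
have E : r`!%:R = r%:R * j`!%:R :> R by rewrite -natrM.
set c := 'C(r, 2)%:R : R.
have c2 : 2 * c = r%:R * j%:R.
  by rewrite /c -!natrM -mul_bin_diag /= bin1.
move=> low.
have cn : 2 * c <= n%:R.
  rewrite c2 -natrM ler_nat; apply: leq_trans n_large; rewrite /r expnS; lia.
set a := r`!%:R * 'C(n, r)%:R : R in low.
have j0 : 0 < j%:R :> R by rewrite ltr0n.
have nj0 : 0 < n%:R ^+ j :> R by rewrite exprn_gt0.
have key2 : a * (r%:R + j%:R * u) < r%:R * n%:R ^+ r.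
  rewrite /a E; have : 0 < r%:R :> R by rewrite ltr0n.
  move=> r0; have := key; rewrite -(ltr_pM2l r0); lra.
have a2 : n%:R ^+ r <= 2 * a.
  have : 2 * c * n%:R ^+ j <= n%:R ^+ r by rewrite [leRHS]exprS ler_pM2r.
  lra.
have ju : 0 <= j%:R * u by rewrite mulr_ge0.
have k3 : n%:R ^+ r * (j%:R * u) < 2 * (r%:R * (c * n%:R ^+ j)).
  have h6 := ler_wpM2r ju a2.
  have r0 : 0 <= r%:R :> R by [].
  have := ler_wpM2l r0 low; move: key2; rewrite mulrDr => h7 h8; lra.
have k4 : j%:R * x v < j%:R * (r%:R * r%:R).
  rewrite xv -(ltr_pM2r nj0); move: k3; rewrite exprS.
  have -> : 2 * (r%:R * (c * n%:R ^+ j)) = r%:R * (2 * c) * n%:R ^+ j by ring.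
  rewrite c2; lra.
by move: k4; rewrite ltr_pM2l // -natrM => /ltW; rewrite expnS expn1.
Qed.

(** With x v <= r^2 known, Bernoulli's inequality puts the geometric sum of [crit_link_sum] within
    O(1/n) of r. *)
Lemma crit_link_ge v : v \in A ->
  n%:R ^+ s.+2 - (r ^ 2 + r ^ 3)%:R * n%:R ^+ s.+1 <= s.+2`!%:R * gwt x (link G v).
Proof.
move=> vA; have hB := crit_link_sum vA; set u := x v / n%:R in hB.
set B := gwt _ _ in hB *.
have xv : x v = n%:R * u by rewrite /u mulrC divfK // gt_eqF.
have u0 : 0 <= u by rewrite divr_ge0 ?(crit_ge0 crit).
have u1 : u <= 1 by rewrite ler_pdivrMr // mul1r crit_le_n.
have xb := crit_bounded v.
have SL : r%:R * (1 - r%:R * u) <= \sum_(i < r) (1 - u) ^+ i.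
  have -> : r%:R * (1 - r%:R * u) = \sum_(i < r) (1 - r%:R * u).
    by rewrite sumr_const card_ord mulr_natl.
  apply: ler_sum => i _; apply: le_trans (bernoulli i _); last by rewrite u0 u1.
  by rewrite lerB // ler_wpM2r // ler_nat ltnW.
have E : r`!%:R = r%:R * s.+2`!%:R :> R by rewrite -natrM.
have low := natr_expn_le_bin n s.+2; rewrite -/r in low.
have up : r`!%:R * 'C(n, r)%:R <= n%:R ^+ r :> R.
  by rewrite -natrM -natrX ler_nat mulnC bin_ffact ffact_le_expn.
have c2 : 'C(r, 2)%:R <= (r ^ 2)%:R :> R by rewrite ler_nat bin_le_expn.
have f0 : 0 < s.+2`!%:R :> R by rewrite ltr0n fact_gt0.
have h1 : s.+2`!%:R * ('C(n, r)%:R * (r%:R * (1 - r%:R * u))) <= s.+2`!%:R * (n%:R * B).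
  rewrite ler_pM2l //; apply: le_trans (ltW hB).
  by apply: ler_wpM2l.
set N := n%:R ^+ s.+1 : R in low *; have N0 : 0 < N by rewrite exprn_gt0.
have N2 : n%:R ^+ s.+2 = n%:R * N by rewrite exprS.
have N3 : n%:R ^+ r = n%:R * (n%:R * N) by rewrite /r exprS N2. 
rewrite N2 N3 in low up *.
rewrite -(ler_pM2l n_gt0).
set a := r`!%:R * 'C(n, r)%:R : R in low up.
have h2 : a * (1 - r%:R * u) <= n%:R * (s.+2`!%:R * B).
  by move: h1; rewrite /a E; lra.
apply: le_trans h2.
have ru0 : 0 <= r%:R * u by rewrite mulr_ge0.
have h3 : a * (r%:R * u) <= (r ^ 3)%:R * (n%:R * N).
  apply: le_trans (ler_wpM2r ru0 up) _.
  have -> : n%:R * (n%:R * N) * (r%:R * u) = (r%:R * x v) * (n%:R * N) by rewrite xv; ring.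
  apply: ler_wpM2r; first by rewrite mulr_ge0 // ltW.
  by rewrite [(r ^ 3)%N]expnS natrM ler_wpM2l.
have h4 : 'C(r, 2)%:R * (n%:R * N) <= (r ^ 2)%:R * (n%:R * N).
  by rewrite ler_wpM2r ?mulr_ge0 // ltW.
rewrite natrD; lra.
Qed.

End Bounds.
End Critical.

(** * The second moment of a critical weighting *)

Section Second.
Variables (R : realFieldType) (T : finType).
Implicit Types (x : T -> R) (A e : {set T}) (G H : {set {set T}}) (j k n : nat).

(** Induction through (j+2) e_(j+2) = n e_(j+1) - [nsum x A 2 j], where [elsym_ge_exp] bounds [nsum]
    from below by nearly n^j / j! times the second moment. The extra factor n on the left avoids the
    power n^(j-1) at j = 0. *)
Lemma elsym_le_psum2 x A n (K r j : nat) : (j < r)%N -> (0 < n)%N -> (r ^ 2 * K <= n)%N ->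
  (forall i, 0 <= x i) -> (forall i, x i <= K%:R) -> \sum_(v in A) x v = n%:R ->
  n%:R * (j.+1`!%:R * elsym x A j.+1) <= n%:R ^+ j.+2 -
    'C(j.+1, 2)%:R * psum x A 2 * (1 - (r ^ 2 * K)%:R / n%:R) * n%:R ^+ j.
Proof.
move=> jr n0 nK x0 xK x1; set d := 1 - _ / _.
have nR : 0 < n%:R :> R by rewrite ltr0n.
elim: j jr => [|j IH] jr.
  by rewrite elsym1 x1 bin_small // !mul0r subr0 mul1r expr2.
set p2 := psum x A 2 in IH *.
have p20 : 0 <= p2 by apply: sumr_ge0 => ? _; exact: sqr_ge0.
have hd : d * n%:R ^+ j <= (n%:R - j.+1%:R * K%:R) ^+ j.
  have -> : n%:R - j.+1%:R * K%:R = n%:R * (1 - (j.+1 * K)%:R / n%:R) :> R.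
    by rewrite natrM; field; rewrite gt_eqF.
  rewrite exprMn mulrC; apply: ler_wpM2l; first by rewrite exprn_ge0 // ltW.
  apply: le_trans (bernoulli j _); last first.
    rewrite divr_ge0 //= ler_pdivrMr // mul1r ler_nat.
    by apply: leq_trans nK; rewrite leq_mul2r expnS; apply/orP; right; nia.
  rewrite /d lerB // mulrA -natrM ler_wpM2r ?invr_ge0 ?(ltW nR) // ler_nat mulnA.
  by rewrite leq_mul2r; apply/orP; right; rewrite expnS expn1 leq_mul //; lia.
have hN : p2 * (d * n%:R ^+ j) <= j`!%:R * nsum x A 2 j.
  rewrite /nsum mulr_sumr /p2 /psum mulr_suml; apply: ler_sum => v vA.
  rewrite [leRHS]mulrCA; apply: ler_wpM2l; first exact: sqr_ge0.
  have E : \sum_(i in A :\ v) x i = n%:R - x v.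
    by have := x1; rewrite (big_setD1 v vA) /=; lra.
  have xv := xK v.
  have jK : j.+1%:R * K%:R <= n%:R :> R.
    rewrite -natrM ler_nat; apply: leq_trans nK; rewrite leq_mul2r.
    by apply/orP; right; rewrite expnS; nia.
  have h := @elsym_ge_exp _ _ x (A :\ v) j K%:R (ler0n _ _) x0 xK.
  apply: le_trans (h _); last by rewrite E; move: jK; rewrite -natr1; lra.
  apply: le_trans hd _; apply: lerXn2r; rewrite ?nnegrE ?subr_ge0 //.
    by rewrite E; move: jK; rewrite -natr1; lra.
  by rewrite E -natr1; lra.
have E2 : j.+2`!%:R * elsym x A j.+2 = n%:R * (j.+1`!%:R * elsym x A j.+1) -
    j.+1%:R * (j`!%:R * nsum x A 2 j).
  rewrite factS mulnC natrM -mulrA elsym_nsum nsum_rec.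
  have -> : psum x A 1 = n%:R by rewrite -x1; apply: eq_bigr => v _; rewrite expr1.
  by rewrite [j.+1`!]factS natrM; ring.
have h1 := IH (ltnW jr).
have h2 : j.+1%:R * (p2 * (d * n%:R ^+ j)) <= j.+1%:R * (j`!%:R * nsum x A 2 j).
  by apply: ler_wpM2l.
rewrite binS bin1 natrD E2 [n%:R ^+ j.+3]exprS [n%:R ^+ j.+1]exprS.
move: h1 h2; set a := _ * elsym _ _ _; set b := _ * nsum _ _ _ _.
set w := n%:R ^+ j.+2; set y := n%:R ^+ j => h1 h2.
have h3 : n%:R * a - j.+1%:R * b <= w - 'C(j.+1, 2)%:R * p2 * d * y - j.+1%:R * (p2 * (d * y)) by lra.
have := ler_wpM2l (ltW nR) h3; lra.
Qed.

Section Bounds.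
Variables (n s : nat) (x : T -> R) (A : {set T}) (G : {set {set T}}).
Let r := s.+3.
Let c := (r ^ 4)%N.
Hypothesis n_large : (2 * r ^ 4 <= n)%N.
Hypothesis crit : critical n r x A G.

Let n_large2 : (2 * r ^ 2 <= n)%N.
Proof. by apply: leq_trans n_large; rewrite leq_mul2l /= leq_pexp2l. Qed.

Let n_gt0 : 0 < n%:R :> R.
Proof. by rewrite ltr0n; move: n_large2; rewrite /r expnS; lia. Qed.

Let main : n%:R * (r`!%:R * elsym x A r) <= n%:R ^+ r.+1 -
    'C(r, 2)%:R * psum x A 2 * (1 - c%:R / n%:R) * n%:R ^+ s.+2.
Proof.
have := @elsym_le_psum2 x A n (r ^ 2) r s.+2 (leqnn _) _ _ (crit_ge0 crit)
  (crit_bounded n_large2 crit) (crit_sum crit).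
rewrite -expnD; apply; first by rewrite -(ltr0n R).
by move: n_large; rewrite /c; lia.
Qed.

Lemma crit_gt_esym : 'C(n, r)%:R < elsym x A r.
Proof.
apply: lt_le_trans (crit_gt crit) _; rewrite elsym_gwt.
by apply: gwt_le (crit_unif crit); exact: crit_ge0 crit.
Qed.

Let main2 : n%:R * (r`!%:R * (elsym x A r - 'C(n, r)%:R)) <=
    'C(r, 2)%:R * n%:R ^+ s.+1 * (n%:R ^+ 2 - psum x A 2 * (n%:R - c%:R)).
Proof.
have low := natr_expn_le_bin R n s.+2; rewrite -/r in low.
have := main; rewrite [n%:R ^+ r.+1]exprS.
have -> : 'C(r, 2)%:R * psum x A 2 * (1 - c%:R / n%:R) * n%:R ^+ s.+2 =
   'C(r, 2)%:R * psum x A 2 * (n%:R - c%:R) * n%:R ^+ s.+1.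
  by rewrite [n%:R ^+ s.+2]exprS; field; rewrite gt_eqF.
have := ler_wpM2l (ltW n_gt0) low; rewrite [n%:R ^+ s.+2]exprS; lra.
Qed.

(** As e_r exceeds ['C(n, r)], the right side of [main2] is nonnegative, so the second moment is at
    most n^2 / (n - c), which is at most n + 2c when n >= 2c. *)
Lemma crit_psum2 : psum x A 2 <= (n + 2 * c)%:R.
Proof.
have h1 : 0 <= n%:R * (r`!%:R * (elsym x A r - 'C(n, r)%:R)).
  by rewrite !mulr_ge0 // subr_ge0 ltW // crit_gt_esym.
have h2 := le_trans h1 main2.
have bp : 0 < 'C(r, 2)%:R * n%:R ^+ s.+1 :> R.
  by rewrite mulr_gt0 ?exprn_gt0 // ltr0n bin_gt0.
rewrite pmulr_rge0 // in h2.
have cn : 2 * c%:R <= n%:R :> R by rewrite -natrM ler_nat.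
have c0 : 0 <= c%:R :> R by [].
rewrite leNgt; apply/negP; rewrite natrD natrM => hlt.
have d0 : 0 < n%:R - c%:R :> R by have := n_gt0; lra.
have := hlt; rewrite -(ltr_pM2r d0); nra.
Qed.

(** Nonnegativity of the sum of (x i - 1)^2 makes the second moment at least 2n - #|A|, which leaves
    little room in [main2]. Since G itself weighs more than ['C(n, r)], this also limits the weight
    of the missing sets. *)
Lemma crit_esym_le : (n <= #|A|)%N ->
  elsym x A r - 'C(n, r)%:R <= (r ^ 2 * (#|A| - n + c))%:R * n%:R ^+ s.+1.
Proof.
move=> nA.
have p2 : 2 * n%:R - #|A|%:R <= psum x A 2.
  have := psum2_shift x A; rewrite (crit_sum crit).
  have : 0 <= psum (fun i => x i - 1) A 2 by apply: sumr_ge0 => ? _; exact: sqr_ge0.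
  lra.
have cn : 2 * c%:R <= n%:R :> R by rewrite -natrM ler_nat.
have c0 : 0 <= c%:R :> R by [].
have d0 : 0 <= n%:R - c%:R :> R by have := n_gt0; lra.
have h := ler_wpM2r d0 p2.
have kn : n%:R <= #|A|%:R :> R by rewrite ler_nat.
have h2 : n%:R ^+ 2 - psum x A 2 * (n%:R - c%:R) <= (#|A| - n + c)%:R * n%:R.
  rewrite natrD natrB //; nra.
have N0 : 0 <= n%:R ^+ s.+1 :> R by rewrite exprn_ge0 // ltW.
have h3 := ler_wpM2l (mulr_ge0 (ler0n R 'C(r, 2)) N0) h2.
have h4 := le_trans main2 h3.
have h5 : r`!%:R * (elsym x A r - 'C(n, r)%:R) <=
    'C(r, 2)%:R * n%:R ^+ s.+1 * (#|A| - n + c)%:R.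
  rewrite -(ler_pM2l n_gt0); lra.
have e0 : 0 <= elsym x A r - 'C(n, r)%:R by rewrite subr_ge0 ltW // crit_gt_esym.
apply: (@le_trans _ _ (r`!%:R * (elsym x A r - 'C(n, r)%:R))).
  by apply: ler_peMl => //; rewrite ler1n fact_gt0.
apply: le_trans h5 _; rewrite natrM -mulrA -[leRHS]mulrA [_ * n%:R ^+ _]mulrC.
by apply: ler_wpM2r; rewrite ?mulr_ge0 // ler_nat bin_le_expn.
Qed.

End Bounds.
End Second.

(** * The support of a critical weighting *)

Section Support.
Variables (R : realFieldType) (T : finType) (s : nat).
Let r := s.+3.
Let c := (r ^ 4)%N.

(** Constant of [crit_degree]: the error of [crit_link_ge], doubled by the factor 2 in
    [gwt_link_sqr], plus the error of [expnD_le] for (n + 2c)^(s+2). *)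
Definition deg_defect := (2 * (r ^ 2 + r ^ 3) + 3 ^ s.+2 * (2 * c))%N.
Definition miss_bound := ((2 * 3 ^ s.+2 + 1) * deg_defect)%N.
Definition var_bound := (2 * c + 2 * deg_defect)%N.
Definition support_bound := (2 * deg_defect + 2 * c + bin_ratio s.+2 *
  (4 * var_bound * miss_bound + 2 ^ r * (r ^ 2 * (2 * deg_defect + c))) + 2 * r)%N.

Variables (n : nat) (x : T -> R) (A : {set T}) (G : {set {set T}}).
Hypothesis n_large : (support_bound < n)%N.
Hypothesis crit : critical n r x A G.
Hypothesis card_G : (#|G| <= 'C(n.+1, r))%N.

Let n_large4 : (2 * c <= n)%N.
Proof. by move: n_large; rewrite /support_bound; lia. Qed.

Let n_larged : (2 * deg_defect <= n)%N.
Proof. by move: n_large; rewrite /support_bound; lia. Qed.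

Let n_large2 : (2 * r ^ 2 <= n)%N.
Proof. by apply: leq_trans n_large4; rewrite leq_mul2l /= leq_pexp2l. Qed.

Let n_gt0 : 0 < n%:R :> R.
Proof. by rewrite ltr0n; move: n_large; lia. Qed.

(** The link of v is heavy by [crit_link_ge] while the second moment is n + O(1), so [gwt_link_sqr]
    forces the link to be numerous. *)
Lemma crit_degree v : v \in A ->
  n%:R ^+ s.+2 - deg_defect%:R * n%:R ^+ s.+1 <= (s.+2`! * #|link G v|)%:R :> R.
Proof.
move=> vA; have h1 := gwt_link_sqr v (crit_unif crit) (crit_ge0 crit).
have h2 := crit_link_ge n_large2 crit vA; rewrite -/r in h2.
have h3 : psum x A 2 ^+ s.+2 <= n%:R ^+ s.+2 + (3 ^ s.+2 * (2 * c))%:R * n%:R ^+ s.+1.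
  apply: (@le_trans _ _ ((n + 2 * c)%:R ^+ s.+2)).
    apply: lerXn2r; rewrite ?nnegrE //.
      by apply: sumr_ge0 => ? _; exact: sqr_ge0.
    exact: crit_psum2 n_large4 crit.
  rewrite -!natrX -natrM -natrD ler_nat; exact: expnD_le.
rewrite /deg_defect natrD [(2 * (_ + _))%:R]natrM [(s.+2`! * _)%:R]natrM. by lra.
Qed.

(** As r >= 3, the product contains (n + 1) n (n - 1) <= n^3. *)
Lemma ffact_succ_le : (n.+1 ^_ r <= n ^ r)%N.
Proof.
rewrite /r ffactnS /= ffactnS mulnA; move: n_large.
case: n => [|m] // _; rewrite /= ffactnS.
have := ffact_le_expn m.-1 s => h.
apply: (@leq_trans (m.+2 * m.+1 * (m * m.-1 ^ s))); first by rewrite !leq_mul2l h !orbT.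
rewrite !expnS.
have h2 : (m.-1 ^ s <= m.+1 ^ s)%N.
  by case: (s) => // s'; rewrite leq_exp2r // (leq_trans (leq_pred m)).
apply: leq_trans (_ : _ <= m.+2 * m.+1 * (m * m.+1 ^ s))%N _.
  by rewrite !leq_mul2l h2 !orbT.
rewrite !mulnA leq_mul2r; apply/orP; right; nia.
Qed.

(** Sum the degrees: by [crit_degree], (r-1)! times their sum is at least #|A| (n - d) n^(r-2) with
    d = [deg_defect], and it is also r! #|G| <= n^r. Hence #|A| (n - d) <= n^2. *)
Lemma crit_card : (#|A| <= n + 2 * deg_defect)%N.
Proof.
have h : #|A|%:R * (n%:R ^+ s.+2 - deg_defect%:R * n%:R ^+ s.+1) <= (n ^ r)%:R :> R.
  rewrite mulr_natl -sumr_const.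
  apply: (@le_trans _ _ (\sum_(v in A) (s.+2`! * #|link G v|)%:R)).
    by apply: ler_sum => v; exact: crit_degree.
  rewrite -natr_sum ler_nat -big_distrr /= (sum_card_link (crit_unif crit)).
  apply: leq_trans ffact_succ_le; rewrite -bin_ffact mulnA mulnC [(_ * r)%N]mulnC.
  by rewrite -factS leq_mul2r card_G orbT.
have N0 : 0 < n%:R ^+ s.+1 :> R by rewrite exprn_gt0.
have h2 : #|A|%:R * (n%:R - deg_defect%:R) <= n%:R * n%:R :> R.
  rewrite -(ler_pM2r N0); move: h; rewrite natrX /r !exprS; lra.
have dn : 2 * deg_defect%:R <= n%:R :> R by rewrite -natrM ler_nat.
have d0 : 0 <= deg_defect%:R :> R by [].
rewrite -(ler_nat R) natrD natrM leNgt; apply/negP => hlt.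
have d1 : 0 < n%:R - deg_defect%:R :> R by have := n_gt0; lra.
by have := hlt; rewrite -(ltr_pM2r d1); nra.
Qed.

Let Miss := draws A r :\: G.

(** A vertex lies in ['C(#|A|.-1, s.+2)] candidate sets; since #|A| = n + O(1), this number and the
    degree in G agree up to O(n^(r-2)). *)
Lemma crit_missing v : v \in A -> (#|link Miss v| <= miss_bound * n ^ s.+1)%N.
Proof.
move=> vA.
have E : link Miss v = draws (A :\ v) s.+2 :\: link G v.
  apply/setP => e; rewrite !inE subsetD1 cardsU1.
  case: (boolP (v \in e)) => ve; rewrite /= ?andbF //= ?andbT.
  by rewrite subUset sub1set vA /= add1n eqSS.
have C1 : #|link Miss v| = ('C(#|A|.-1, s.+2) - #|link G v|)%N.
  rewrite E cardsD (setIidPr (link_draws v (crit_unif crit))) card_draws_set.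
  by rewrite (cardsD1 v A) vA.
have h1 := crit_degree vA; move: h1; rewrite -!natrX -natrM lerBlDr -natrD ler_nat => h1.
have h2 : (s.+2`! * 'C(#|A|.-1, s.+2) <= n ^ s.+2 + 3 ^ s.+2 * (2 * deg_defect) * n ^ s.+1)%N.
  apply: leq_trans (expnD_le _ n_larged); rewrite mulnC bin_ffact.
  apply: leq_trans (ffact_le_expn _ _) _; rewrite leq_exp2r //.
  by have := crit_card; lia.
apply: (@leq_trans (s.+2`! * #|link Miss v|)%N); first by rewrite leq_pmull // fact_gt0.
rewrite C1 mulnBr /miss_bound; move: h1 h2.
rewrite mulnDl mul1n mulnDl -!mulnA; lia.
Qed.

Lemma crit_variance : psum (fun i => x i - 1) A 2 <= var_bound%:R.
Proof.
rewrite psum2_shift (crit_sum crit).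
have := crit_psum2 n_large4 crit; rewrite -/r -/c.
have := crit_card; rewrite -(ler_nat R) /var_bound !natrD.
lra.
Qed.

Let bad := [set v in A | x v < 2^-1].

Lemma card_bad : (#|bad| <= 4 * var_bound)%N.
Proof.
rewrite -(ler_nat R) natrM.
have h : #|bad|%:R * 4^-1 <= psum (fun i => x i - 1) A 2.
  rewrite mulr_natl -sumr_const /psum [leRHS](big_setID bad) /=.
  have -> : A :&: bad = bad by apply/setIidPr/subsetP => v; rewrite inE => /andP[].
  rewrite -[leLHS]addr0; apply: lerD; last by apply: sumr_ge0 => ? _; exact: sqr_ge0.
  by apply: ler_sum => v; rewrite inE => /andP[_ xv]; nra.
have := crit_variance; lra.
Qed.

Lemma crit_support : (#|A| <= n.+1)%N.
Proof.
rewrite leqNgt; apply/negP => big.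
(* Missing sets that avoid the light vertices weigh at least 2^-r each, so a bound on the missing
   weight bounds their number. *)
pose Good := [set e in Miss | [disjoint e & bad]].
have GoodM : Good \subset Miss by apply/subsetP => e; rewrite inE => /andP[].
have hG : #|Good|%:R * (2^-1) ^+ r <= gwt x Miss.
  apply: le_trans (gwt_le (crit_ge0 crit) GoodM).
  rewrite mulrC; apply: gwt_ge_card => e.
  rewrite !inE => /andP[/andP[_ /andP[/subsetP eA /eqP er]] dis].
  rewrite -er /mon -prodr_const; apply: ler_prod => i ie; rewrite invr_ge0 ler0n /=.
  rewrite leNgt; apply/negP => xi.
  by move/disjoint_setI0/setP: dis => /(_ i); rewrite !inE ie eA // xi.
have hM : gwt x Miss <= (r ^ 2 * (2 * deg_defect + c))%:R * n%:R ^+ s.+1.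
  have := crit_esym_le n_large4 crit (ltnW (ltnW big)).
  rewrite -/r elsym_gwt (gwt_setD x (crit_unif crit)) -/Miss => h.
  have h1 : gwt x Miss <= (r ^ 2 * (#|A| - n + r ^ 4))%:R * n%:R ^+ s.+1.
    by have := crit_gt crit; lra.
  apply: le_trans h1 _; rewrite ler_wpM2r ?exprn_ge0 ?(ltW n_gt0) // ler_nat.
  by rewrite leq_mul2l -/c; apply/orP; right; have := crit_card; lia.
have cG : (#|Good| <= 2 ^ r * (r ^ 2 * (2 * deg_defect + c)) * n ^ s.+1)%N.
  have := le_trans hG hM; rewrite exprVn ler_pdivrMr ?exprn_gt0 // -!natrX -!natrM.
  by rewrite ler_nat; lia.
have cM : (#|Miss| <= #|Good| + 4 * var_bound * miss_bound * n ^ s.+1)%N.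
  have -> : #|Miss| = (#|Good| + #|Miss :\: Good|)%N.
    by rewrite cardsD (setIidPr GoodM) subnKC // subset_leq_card.
  rewrite leq_add2l.
  have -> : Miss :\: Good = [set e in Miss | ~~ [disjoint e & bad]].
    apply/setP => e; rewrite in_setD [e \in Good]in_set [in RHS]in_set.
    by case: (e \in Miss); case: [disjoint _ & _].
  apply: leq_trans (card_meet _ _) _.
  apply: (@leq_trans (\sum_(v in bad) miss_bound * n ^ s.+1)).
    by apply: leq_sum => v; rewrite inE => /andP[vA _]; exact: crit_missing.
  by rewrite sum_nat_const -[leqRHS]mulnA leq_mul2r card_bad orbT.
(* With #|A| >= n + 2, at least ['C(n.+2, r)] - ['C(n.+1, r)] sets are missing. This is of order
   n^(r-1), whereas [cG] and [cM] allow only O(n^(r-2)). *)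
have lM : ('C(n.+1, s.+2) <= #|Miss|)%N.
  rewrite cardsD (setIidPr (crit_unif crit)) card_draws_set.
  have : ('C(n.+2, r) <= 'C(#|A|, r))%N by apply: leq_bin2l.
  have -> : 'C(n.+2, r) = ('C(n.+1, r) + 'C(n.+1, s.+2))%N by exact: binS.
  by move: card_G; lia.
have lo := @expn_le_bin n.+1 s.+2 _.
have {}lo : (n ^ s.+2 <= bin_ratio s.+2 * 'C(n.+1, s.+2))%N.
  apply: leq_trans (lo _); first by rewrite leq_exp2r.
  by move: n_large; rewrite /support_bound /r; lia.
have fin : (n ^ s.+2 <= bin_ratio s.+2 * (4 * var_bound * miss_bound +
   2 ^ r * (r ^ 2 * (2 * deg_defect + c))) * n ^ s.+1)%N.
  apply: leq_trans lo _; rewrite -mulnA leq_mul2l; apply/orP; right.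
  apply: leq_trans lM _; apply: leq_trans cM _; rewrite mulnDl addnC leq_add2l //.
move: fin; rewrite expnS leq_mul2r; case/orP.
  by rewrite expn_eq0 => /andP[/eqP n0 _]; move: n_large; rewrite n0.
by move: n_large; rewrite /support_bound; lia.
Qed.

End Support.

(** * Degrees and deviations of products *)

Section ProductDeviation.
Variables (R : realFieldType) (T : finType).
Implicit Types (x y : T -> R) (A B e : {set T}) (F G H : {set {set T}}) (j k n : nat).

(** The two bounds are proved together because the induction step of the second-order bound uses the
    first-order one. *)
Lemma prod_dev_seq y (eps : R) (u : seq T) : 0 <= eps <= 1 ->
  {in u, forall i, `|y i| <= eps} ->
  (`|\prod_(i <- u) (1 + y i) - 1| <= 2 ^+ size u * \sum_(i <- u) `|y i|) /\
  (`|\prod_(i <- u) (1 + y i) - 1 - \sum_(i <- u) y i| <=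
     (2 ^ size u * size u)%:R * eps * \sum_(i <- u) `|y i|).
Proof.
move=> /andP[e0 e1]; elim: u => [|v u IH] yu.
  by rewrite !big_nil subrr subr0 normr0 !mulr0.
have yv : `|y v| <= eps by apply: yu; rewrite mem_head.
have {}yu : {in u, forall i, `|y i| <= eps} by move=> i iu; apply: yu; rewrite inE iu orbT.
have [] := IH yu; rewrite !big_cons /=.
set P := \prod_(i <- u) _; set S := \sum_(i <- u) y i; set N := \sum_(i <- u) `|y i|.
have N0 : 0 <= N by apply: sumr_ge0.
have Nu : N <= (size u)%:R * eps.
  have -> : (size u)%:R * eps = \sum_(i <- u) eps.
    by rewrite big_const_seq count_predT iter_addr_0 mulr_natl.
  by rewrite /N big_seq [leRHS]big_seq; apply: ler_sum.
have p1 : 1 <= 2 ^+ size u :> R by rewrite exprn_ege1 // ler1n.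
move=> h1 h2; split.
  have -> : (1 + y v) * P - 1 = (P - 1) + y v * (P - 1) + y v by ring.
  apply: le_trans (ler_normD _ _) _; apply: le_trans (lerD (ler_normD _ _) (lexx _)) _.
  rewrite normrM exprS.
  have : `|y v| * `|P - 1| <= 1 * (2 ^+ size u * N).
    by apply: ler_pM => //; apply: le_trans yv e1.
  have : `|y v| <= 2 ^+ size u * `|y v| by apply: ler_peMl.
  have : 0 <= `|y v| by []; nra.
have -> : (1 + y v) * P - 1 - (y v + S) = (P - 1 - S) + y v * (P - 1) by ring.
apply: le_trans (ler_normD _ _) _; rewrite normrM.
have q1 : (2 ^ size u * size u)%:R <= (2 ^ (size u).+1 * (size u).+1)%:R :> R.
  by rewrite ler_nat leq_mul // leq_exp2l.
have h3 : `|y v| * `|P - 1| <= `|y v| * ((2 ^ size u * size u)%:R * eps).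
  apply: ler_wpM2l => //; apply: le_trans h1 _.
  by rewrite natrM natrX -mulrA ler_wpM2l // exprn_ge0.
rewrite mulrDr addrC; apply: lerD.
  apply: le_trans h3 _; rewrite mulrC ler_wpM2r // ler_wpM2r //.
by apply: le_trans h2 _; rewrite ler_wpM2r // ler_wpM2r.
Qed.

Lemma prod_dev1 y (eps : R) e : 0 <= eps <= 1 -> {in e, forall i, `|y i| <= eps} ->
  `|mon (fun i => 1 + y i) e - 1| <= 2 ^+ #|e| * \sum_(i in e) `|y i|.
Proof.
move=> he hy; have [] := @prod_dev_seq y eps (enum e) he.
  by move=> i; rewrite mem_enum; apply: hy.
by rewrite !big_enum /= -cardE.
Qed.

Lemma prod_dev2 y (eps : R) e : 0 <= eps <= 1 -> {in e, forall i, `|y i| <= eps} ->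
  `|mon (fun i => 1 + y i) e - 1 - \sum_(i in e) y i| <=
     (2 ^ #|e| * #|e|)%:R * eps * \sum_(i in e) `|y i|.
Proof.
move=> he hy; have [] := @prod_dev_seq y eps (enum e) he.
  by move=> i; rewrite mem_enum; apply: hy.
by rewrite !big_enum /= -cardE.
Qed.

Lemma prod_dev0 y (eps : R) e : 0 <= eps <= 1 -> {in e, forall i, `|y i| <= eps} ->
  `|mon (fun i => 1 + y i) e - 1| <= (2 ^ #|e| * #|e|)%:R * eps.
Proof.
move=> he hy; apply: le_trans (prod_dev1 he hy) _.
rewrite natrM natrX -mulrA ler_wpM2l ?exprn_ge0 //.
by rewrite mulr_natl -sumr_const; apply: ler_sum => i; apply: hy.
Qed.

Lemma eq_mon x y e : {in e, x =1 y} -> mon x e = mon y e.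
Proof. by move=> xy; apply: eq_bigr. Qed.

Lemma sum_degree (V : nmodType) (g : T -> V) F B j : F \subset draws B j ->
  \sum_(f in F) \sum_(i in f) g i = \sum_(i in B) g i *+ #|link F i|.
Proof.
move=> /subsetP FB.
rewrite (exchange_big_dep (fun i => i \in B)) /=; last first.
  by move=> f i /FB; rewrite inE => /andP[/subsetP fB _] /fB.
apply: eq_bigr => i iB; rewrite (sum_link (fun=> g i)) sumr_const //.
Qed.

Lemma sum_degree_nat (g : T -> nat) F B j : F \subset draws B j ->
  (\sum_(f in F) \sum_(i in f) g i = \sum_(i in B) g i * #|link F i|)%N.
Proof.
move=> FB; rewrite (@sum_degree nat g F B j FB); apply: eq_bigr => i _.
by rewrite -mulr_natr natn.
Qed.

(* Two members of F sharing a pair are rare, and m <= 1 + 'C(m, 2). *)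
Lemma sum_codegree F B q : F \subset draws B q.+2 ->
  (\sum_(i in B) #|link F i| ^ 2 <= #|F| ^ 2 + #|F| * (q.+2 ^ 2 * #|B| ^ q))%N.
Proof.
move=> FB; have FB' := subsetP FB.
have -> : (\sum_(i in B) #|link F i| ^ 2 = \sum_(f in F) \sum_(g in F) #|f :&: g|)%N.
  transitivity (\sum_(f in F) \sum_(i in f) #|link F i|)%N.
    by rewrite (sum_degree_nat _ FB); apply: eq_bigr => i _; rewrite expnS expn1.
  apply: eq_bigr => f fF.
  transitivity (\sum_(i in f) \sum_(g in F | i \in g) 1)%N.
    by apply: eq_bigr => i _; rewrite (sum_link (fun=> 1%N)) sum1_card.
  rewrite (exchange_big_dep (fun g => g \in F)) /=; last by move=> ? ? _ /andP[].
  apply: eq_bigr => g gF; rewrite sum1dep_card; apply: eq_card => i.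
  by rewrite !inE gF /=.
have cle m : (m <= 1 + 'C(m, 2))%N.
  by elim: m => [//|[|m] IH] //; rewrite binS bin1; lia.
apply: (@leq_trans (\sum_(f in F) (#|F| + q.+2 ^ 2 * #|B| ^ q))%N); last first.
  by rewrite sum_nat_const mulnDr expnS expn1.
apply: leq_sum => f fF.
apply: (@leq_trans (\sum_(g in F) (1 + 'C(#|f :&: g|, 2)))%N).
  by apply: leq_sum => g _; apply: cle.
rewrite big_split /= sum1_card leq_add2l.
have -> : (\sum_(g in F) 'C(#|f :&: g|, 2) = \sum_(g in F) \sum_(p in draws f 2 | p \subset g) 1)%N.
  apply: eq_bigr => g _; rewrite -card_draws_set sum1dep_card; apply: eq_card => p.
  by rewrite !inE subsetI -!andbA [(p \subset g) && _]andbC.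
rewrite (exchange_big_dep (fun p => p \in draws f 2)) /=; last by move=> ? ? _ /andP[].
have := FB' _ fF; rewrite inE => /andP[fB /eqP fq].
apply: (@leq_trans (\sum_(p in draws f 2) #|B| ^ q)%N); last first.
  rewrite sum_nat_const leq_mul2r card_draws_set fq bin_le_expn orbT //.
apply: leq_sum => p pf; rewrite sum1dep_card.
have [pf1 /eqP p2] : p \subset f /\ #|p| == 2 by move: pf; rewrite inE => /andP[].
apply: (@leq_trans #|[set e : {set T} | [&& e \subset B, #|e| == q.+2 & p \subset e]]|).
  apply: subset_leq_card; apply/subsetP => g; rewrite !inE => /andP[/FB'].
  by rewrite inE => /andP[-> ->] /andP[_ ->].
rewrite card_subsets ?p2 //; last exact: subset_trans fB.
apply: leq_trans (bin_le_expn _ _) _; rewrite !subSS subn0.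
by case: (q) => // m; rewrite leq_exp2r // leq_subr.
Qed.

Lemma gwt_link_all x H v : (forall e, e \in H -> v \in e) ->
  gwt x H = x v * gwt x (link H v).
Proof.
move=> hv; rewrite (gwt_link x H v) big_pred0 ?addr0 // => e.
by apply/negbTE/negP => /andP[/hv ->].
Qed.

Lemma card_link_all H v : (forall e, e \in H -> v \in e) -> #|link H v| = #|H|.
Proof.
move=> hv; rewrite -sum1_card -(sum_link (fun=> 1%N)) -[RHS]sum1_card.
by apply: eq_bigl => e; case: (boolP (e \in H)) => //= /hv ->.
Qed.

End ProductDeviation.

(** * Exchanging edges at the two lightest vertices *)

(** The inequality that closes [total] in [swap_bound], isolated in plain variables for linear
    arithmetic: [zq] and [zC] stand for z q^2 N and z C0 N, and [e] for the error caused by the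
    degrees in F'. *)
Lemma swap_arith (R : realFieldType) (th z M X e zq zC : R) :
  z * (2 * X) <= z * (th ^+ 2 * M) ->
  z * ((2 - 2 * th - 3 / 4 * th ^+ 2) * z) <= z * ((2 - 2 * th - 3 / 4 * th ^+ 2) * M) ->
  0 <= z * X -> 0 <= th * zC -> z * X = 3 * zq + e + 2 * zC ->
  (1 - th) ^+ 2 * z ^+ 2 + ((1 - 2 * th ^+ 2) * z ^+ 2 + 2 * zq +
    (e + (th ^+ 2 / 4 * z ^+ 2 + zq))) <= 2 * (1 - th) * (z * M) - 2 * (1 - th) * zC.
Proof. by move=> *; lra. Qed.

Section PairSwap.
Variables (R : realFieldType) (T : finType) (s : nat).
Let q := s.+2.
Let c1 := (2 ^ q)%N.
Let c2 := (2 ^ q * q)%N.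

(** Chosen so that [c2] / L <= th^2 / 4 for th = 1 / (2q): linearisation errors then stay below the
    gain of order th^2 in [swap_bound]. *)
Definition swap_prec := (16 * c2 * q ^ 2)%N.
(** With 8 q^2 = 2 / th^2, the condition M >= [swap_ratio C0] n^s says that all errors of order z
    n^s fit into half of th^2 z M. *)
Definition swap_ratio (C0 : nat) :=
  (8 * q ^ 2 * (3 * q ^ 2 + 2 * (1 + 4 * q ^ 2) * c1 ^ 2 * q + 2 * C0))%N.

Lemma swap_prec_ge : (16 * c2 <= swap_prec)%N.
Proof. by rewrite leq_pmulr // expn_gt0. Qed.

Lemma swap_prec_gt0 : (0 < swap_prec)%N.
Proof. by apply: leq_trans swap_prec_ge; rewrite muln_gt0 muln_gt0 expn_gt0. Qed.

Lemma swap_ratio_ge C0 : (2 * C0 <= swap_ratio C0)%N.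
Proof.
rewrite /swap_ratio mulnDr; apply: leq_trans (leq_addl _ _); apply: leq_pmull.
by rewrite muln_gt0 expn_gt0.
Qed.

Variables (L n C0 : nat) (y : T -> R) (V : {set T}) (F F' : {set {set T}}).
Variables (M xa xb ya : R) (z : nat).
Hypotheses (L_large : (swap_prec <= L)%N) (cardV : (0 < #|V| <= n)%N).
Hypotheses (FV : F \subset draws V q) (FV' : F' \subset draws V s.+1).
Hypotheses (cardF : #|F| = z) (cardF' : #|F'| = z).
Hypotheses (y_small : {in V, forall i, `|y i| <= L%:R^-1}).
Hypotheses (xb0 : 0 <= xb) (xa0 : 0 <= xa) (xa1 : xa <= 1) (xaE : xa = 1 + ya - xb).
Hypothesis xa_le : {in V, forall i, xa <= 1 + y i}.
Hypotheses (zM : z%:R <= M) (M_large : (swap_ratio C0)%:R * n%:R ^+ s <= M).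

Let eps : R := L%:R^-1.
Let N : R := n%:R ^+ s.
Let th : R := (2 * q%:R)^-1.
Let D i : R := #|link F i|%:R.
Let D' i : R := #|link F' i|%:R.

Let eps01 : 0 <= eps <= 1.
Proof.
have L1 : (1 <= L)%N := leq_trans swap_prec_gt0 L_large.
by rewrite invr_ge0 ler0n invf_le1 ?ltr0n // ler1n.
Qed.

Let q0 : 0 < q%:R :> R. Proof. by rewrite ltr0n. Qed.

Let th_q : 2 * q%:R * th = 1.
Proof. by rewrite /th mulfV // mulf_neq0 ?pnatr_eq0. Qed.

Let t2q : 4 * q%:R ^+ 2 * th ^+ 2 = 1.
Proof.
have -> : 4 * q%:R ^+ 2 * th ^+ 2 = (2 * q%:R * th) ^+ 2 by ring.
by rewrite th_q expr1n.
Qed.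

Let th0 : 0 < th. Proof. by rewrite invr_gt0 mulr_gt0. Qed.

Let th1 : th <= 2^-1 * 2^-1.
Proof.
have : 2 <= q%:R :> R by rewrite ler_nat.
by have := th0; have := th_q; nra.
Qed.

Let c2eps : c2%:R * eps <= th ^+ 2 / 4.
Proof.
have L0 : 0 < L%:R :> R.
  by rewrite ltr0n; exact: leq_trans swap_prec_gt0 L_large.
rewrite ler_pdivrMr //.
have h : (16 * c2 * q ^ 2)%:R <= L%:R :> R by rewrite ler_nat.
have t2 := t2q.
have h2 : th ^+ 2 * (16 * c2 * q ^ 2)%:R <= th ^+ 2 * L%:R by rewrite ler_wpM2l ?sqr_ge0.
have -> : c2%:R = th ^+ 2 * (16 * c2 * q ^ 2)%:R / 4 :> R.
  by rewrite natrM natrX natrM; transitivity (4 * q%:R ^+ 2 * th ^+ 2 * c2%:R); [rewrite t2 mul1r|field].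
lra.
Qed.

Let z0 : 0 <= z%:R :> R. Proof. by []. Qed.
Let N0 : 0 <= N. Proof. by rewrite exprn_ge0. Qed.

Let zqN : 0 <= z%:R * (q%:R ^+ 2 * N).
Proof. exact: mulr_ge0 z0 (mulr_ge0 (sqr_ge0 _) N0). Qed.

Lemma sum_deg_sqr : \sum_(i in V) D i ^+ 2 <= z%:R ^+ 2 + z%:R * (q%:R ^+ 2 * N).
Proof.
have h := sum_codegree FV; rewrite cardF in h.
have -> : \sum_(i in V) D i ^+ 2 = (\sum_(i in V) #|link F i| ^ 2)%:R.
  by rewrite natr_sum; apply: eq_bigr => i _; rewrite natrX.
rewrite /N -!natrX -!natrM -natrD ler_nat; apply: leq_trans h _.
rewrite leq_add2l leq_mul2l leq_mul2l; apply/orP; right; apply/orP; right.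
by case: (s) => // m; rewrite leq_exp2r //; case/andP: cardV.
Qed.

(** The sets of F' have only s + 1 elements, so every degree is at most n^s and the sum of squares
    is linear in z. *)
Lemma sum_deg_sqr' : \sum_(i in V) D' i ^+ 2 <= q%:R * z%:R * N.
Proof.
have dN i : i \in V -> D' i <= N.
  move=> iV; rewrite /D' /N -natrX ler_nat.
  apply: leq_trans (subset_leq_card (link_draws i FV')) _.
  rewrite card_draws_set; apply: leq_trans (bin_le_expn _ _) _.
  case: (s) => // m; rewrite leq_exp2r //; case/andP: cardV => _.
  by apply: leq_trans; rewrite subset_leq_card // subsetDl.
apply: (@le_trans _ _ (\sum_(i in V) D' i * N)).
  by apply: ler_sum => i iV; rewrite expr2 ler_wpM2l // dN.
rewrite -mulr_suml ler_wpM2r //.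
have -> : \sum_(i in V) D' i = (\sum_(i in V) #|link F' i|)%:R by rewrite natr_sum.
by rewrite (sum_card_link FV') cardF' natrM ler_wpM2r // ler_nat.
Qed.

(* F' and F are the links of the gained and of the lost edges, y and ya the deviations.
   When z is close to M the quadratic form obtained from xa = 1 + ya - xb alone is only
   borderline; mixing in xa <= 1 + y js, for js of maximal degree in F, with weight
   th = 1 / (2 q) gains a factor 1 - O(th ^+ 2). *)
Lemma swap_bound :
  xb * (xa * gwt (fun i => 1 + y i) F' - gwt (fun i => 1 + y i) F) <=
  (M - C0%:R * N) / 2 * (ya ^+ 2 + psum y V 2).
Proof.
have [j0 j0V] : exists j0, j0 \in V by apply/set0Pn; rewrite -card_gt0; case/andP: cardV.
have [js jsV js_max] := @arg_maxnP _ j0 (mem V) (fun i => #|link F i|) j0V.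
have SD := sum_deg_sqr; set S := \sum_(i in V) D i ^+ 2 in SD.
have SD' := sum_deg_sqr'; set S' := \sum_(i in V) D' i ^+ 2 in SD'.
have S0 : 0 <= S by apply: sumr_ge0 => ? _; exact: sqr_ge0.
have Dmax : S <= q%:R * z%:R * D js.
  have -> : q%:R * z%:R = \sum_(i in V) D i.
    by rewrite -natr_sum (sum_card_link FV) cardF natrM.
  rewrite mulr_suml; apply: ler_sum => i iV; rewrite expr2 ler_wpM2l //.
  by rewrite ler_nat; apply: js_max.
(* [g] gathers the linear terms in y: the share th of the bound on xa at [js], minus the degrees of
   the lost edges. [h] collects the linearisation errors of F' and F, and [u] bounds the resulting
   coefficient of |y i|. *)
pose g i := th * z%:R * (i == js)%:R - D i.
pose h i := c1%:R * D' i + c2%:R * eps * D i.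
pose u i := `|g i| + h i.
have h_ge0 i : 0 <= h i.
  by case/andP: eps01 => e0 _; rewrite addr_ge0 ?mulr_ge0.
have W : xa * gwt (fun i => 1 + y i) F' - gwt (fun i => 1 + y i) F <=
    - (1 - th) * z%:R * xb + (1 - th) * z%:R * `|ya| + \sum_(i in V) u i * `|y i|.
  have WF' : xa * gwt (fun i => 1 + y i) F' <= z%:R * xa + \sum_(i in V) c1%:R * D' i * `|y i|.
    have -> : \sum_(i in V) c1%:R * D' i * `|y i| =
              \sum_(f in F') \sum_(i in f) c1%:R * `|y i|.
      by rewrite (sum_degree _ FV'); apply: eq_bigr => i _; rewrite -mulr_natr; ring.
    rewrite /gwt mulr_sumr -cardF' mulr_natl -sumr_const -big_split /=.
    apply: ler_sum => f /(subsetP FV'); rewrite inE => /andP[/subsetP fV /eqP fc].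
    have := @prod_dev1 _ _ y eps f eps01 (fun i ix => y_small (fV i ix)).
    rewrite ler_norml => /andP[_]; rewrite lerBlDl fc => hm.
    apply: (@le_trans _ _ (xa + xa * (2 ^+ s.+1 * \sum_(i in f) `|y i|))).
      by rewrite -[X in X + _]mulr1 -mulrDr ler_wpM2l.
    rewrite lerD2l -mulr_sumr; apply: (@le_trans _ _ (2 ^+ s.+1 * \sum_(i in f) `|y i|)).
      by apply: ler_piMl => //; rewrite mulr_ge0 ?exprn_ge0 ?sumr_ge0.
    by rewrite ler_wpM2r ?sumr_ge0 // /c1 natrX ler_weXn2l ?ler1n.
  have WF : z%:R + \sum_(i in V) D i * y i - \sum_(i in V) c2%:R * eps * D i * `|y i| <=
            gwt (fun i => 1 + y i) F.
    have -> : \sum_(i in V) D i * y i = \sum_(f in F) \sum_(i in f) y i.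
      by rewrite (sum_degree _ FV); apply: eq_bigr => i _; rewrite -mulr_natr mulrC.
    have -> : \sum_(i in V) c2%:R * eps * D i * `|y i| =
              \sum_(f in F) \sum_(i in f) c2%:R * eps * `|y i|.
      by rewrite (sum_degree _ FV); apply: eq_bigr => i _; rewrite -mulr_natr; ring.
    rewrite /gwt -cardF -sumr_const -big_split /= -sumrB.
    apply: ler_sum => f /(subsetP FV); rewrite inE => /andP[/subsetP fV /eqP fc].
    have := @prod_dev2 _ _ y eps f eps01 (fun i ix => y_small (fV i ix)).
    rewrite fc -/c2 -mulr_sumr ler_norml => /andP[hm _]; lra.
  have xa2 : z%:R * xa <= z%:R * (1 + ((1 - th) * (ya - xb) + th * y js)).
    rewrite ler_wpM2l //; have := xa_le jsV; have := xaE; have := th0; have := th1; nra.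
  have sumg : th * z%:R * y js - \sum_(i in V) D i * y i <= \sum_(i in V) `|g i| * `|y i|.
    have -> : th * z%:R * y js = \sum_(i in V) th * z%:R * (i == js)%:R * y i.
      rewrite (bigD1 js) //= eqxx mulr1 big1 ?addr0 // => i /andP[_ /negbTE ->].
      by rewrite mulr0 mul0r.
    rewrite -sumrB; apply: ler_sum => i _; rewrite -mulrBl -normrM; exact: ler_norm.
  have -> : \sum_(i in V) u i * `|y i| = \sum_(i in V) `|g i| * `|y i| +
     (\sum_(i in V) c1%:R * D' i * `|y i| + \sum_(i in V) c2%:R * eps * D i * `|y i|).
    by rewrite -!big_split /=; apply: eq_bigr => i _; rewrite /u /h; ring.
  have yaN : (1 - th) * z%:R * ya <= (1 - th) * z%:R * `|ya|.
    rewrite ler_wpM2l ?ler_norm // mulr_ge0 //; have := th1; lra.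
  lra.
have gsum : \sum_(i in V) g i ^+ 2 = S - 2 * (th * z%:R) * D js + (th * z%:R) ^+ 2.
  have -> : 2 * (th * z%:R) * D js = \sum_(i in V) 2 * (th * z%:R) * (i == js)%:R * D i.
    rewrite (bigD1 js) //= eqxx mulr1 big1 ?addr0 // => i /andP[_ /negbTE ->].
    by rewrite mulr0 mul0r.
  have -> : (th * z%:R) ^+ 2 = \sum_(i in V) (th * z%:R) ^+ 2 * (i == js)%:R.
    by rewrite (bigD1 js) //= eqxx mulr1 big1 ?addr0 // => i /andP[_ /negbTE ->]; rewrite mulr0.
  rewrite -sumrB -big_split /=; apply: eq_bigr => i _; rewrite /g.
  by case: (i == js); rewrite ?mulr1 ?mulr0; ring.
(* (|g| + h)^2 <= (1 + th^2) g^2 + (1 + th^-2) h^2, so the main part grows only by the factor 1 +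
   th^2. *)
have usum : \sum_(i in V) u i ^+ 2 <= (1 + th ^+ 2) * (\sum_(i in V) g i ^+ 2) +
   (1 + th ^- 2) * (2 * c1%:R ^+ 2 * S' + 2 * (c2%:R * eps) ^+ 2 * S).
  rewrite mulrDr !mulr_sumr -!big_split /=; apply: ler_sum => i _.
  have t2 : 0 < th ^+ 2 by rewrite exprn_gt0.
  have hk : u i ^+ 2 <= (1 + th ^+ 2) * g i ^+ 2 + (1 + th ^- 2) * h i ^+ 2.
    rewrite /u -[g i ^+ 2]real_normK ?num_real //.
    have := sqr_ge0 (th * `|g i| - th^-1 * h i).
    have -> : (th * `|g i| - th^-1 * h i) ^+ 2 =
      th ^+ 2 * `|g i| ^+ 2 + th ^- 2 * h i ^+ 2 - 2 * `|g i| * h i.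
      by field; rewrite gt_eqF.
    lra.
  apply: le_trans hk _; rewrite lerD2l -mulrDr; apply: ler_wpM2l.
    by rewrite addr_ge0 // invr_ge0 ltW.
  rewrite /h; move: (c1%:R) (c2%:R * eps) (D' i) (D i) => k1 k2 d1 d2.
  by have := sqr_ge0 (k1 * d1 - k2 * d2); lra.
have iq : th ^- 2 = 4 * q%:R ^+ 2.
  by apply: (@mulIf _ (th ^+ 2)); rewrite ?t2q ?mulVf // gt_eqF // exprn_gt0.
(* The discriminant condition: with M' = M - C0 N it lets the negative term -(1 - th) z xb^2 absorb
   the xb^2 terms produced by AM-GM below. *)
have total : (1 - th) ^+ 2 * z%:R ^+ 2 + \sum_(i in V) u i ^+ 2 <=
   2 * (1 - th) * z%:R * (M - C0%:R * N).
  (* Since q = 1 / (2 th), [Dmax] makes the cross term at least 4 th^2 S. This is the source of the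
     gain 1 - 3 th^2. *)
  have g1 : \sum_(i in V) g i ^+ 2 <= (1 - 3 * th ^+ 2) * z%:R ^+ 2 + z%:R * (q%:R ^+ 2 * N).
    have e1 : 4 * th ^+ 2 * S <= 2 * (th * z%:R) * D js.
      have := ler_wpM2l (ltW (exprn_gt0 2 th0)) Dmax.
      have -> : th ^+ 2 * (q%:R * z%:R * D js) = (2 * q%:R * th) * (th * z%:R * D js) / 2 by field.
      rewrite th_q; lra.
    have t3 : 0 <= 1 - 4 * th ^+ 2 by have := th0; have := th1; nra.
    have e2 := ler_wpM2l t3 SD.
    have e3 : 0 <= th ^+ 2 * (z%:R * (q%:R ^+ 2 * N)) by exact: mulr_ge0 (sqr_ge0 _) zqN.
    rewrite gsum; lra.
  have e4 : (c2%:R * eps) ^+ 2 <= th ^+ 4 / 16.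
    have -> : th ^+ 4 / 16 = (th ^+ 2 / 4) ^+ 2 by field.
    case/andP: eps01 => e0 _.
    apply: lerXn2r; rewrite ?nnegrE; [exact: mulr_ge0| |exact: c2eps].
    by apply: divr_ge0 => //; exact: sqr_ge0.
  have e5 : (1 + th ^- 2) * (2 * (c2%:R * eps) ^+ 2 * S) <= th ^+ 2 / 4 * S.
    rewrite mulrA; apply: ler_wpM2r => //.
    apply: (@le_trans _ _ ((1 + th ^- 2) * (2 * (th ^+ 4 / 16)))).
      by rewrite ler_wpM2l ?addr_ge0 ?invr_ge0 ?exprn_ge0 ?(ltW th0) // ler_wpM2l.
    have -> : (1 + th ^- 2) * (2 * (th ^+ 4 / 16)) = th ^+ 2 * (th ^+ 2 + 1) / 8.
      by field; rewrite gt_eqF.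
    have t7 : th ^+ 2 <= 1 by have := th0; have := th1; nra.
    have := ler_wpM2l (sqr_ge0 th) t7; lra.
  have e6 : (1 + th ^- 2) * (2 * c1%:R ^+ 2 * S') <=
      (1 + 4 * q%:R ^+ 2) * (2 * c1%:R ^+ 2 * (q%:R * z%:R * N)).
    rewrite iq ler_wpM2l ?addr_ge0 ?mulr_ge0 ?sqr_ge0 //.
    by rewrite ler_wpM2l ?mulr_ge0 ?sqr_ge0.
  have e7 : th ^+ 2 / 4 * S <= th ^+ 2 / 4 * z%:R ^+ 2 + z%:R * (q%:R ^+ 2 * N).
    have t4 : 0 <= th ^+ 2 / 4 <= 1 by have := th0; have := th1; nra.
    case/andP: t4 => t4 t5.
    have := ler_wpM2l t4 SD; rewrite mulrDr.
    have := ler_wpM2r zqN t5; lra.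
  have e8 : (1 + th ^+ 2) * (\sum_(i in V) g i ^+ 2) <=
      (1 - 2 * th ^+ 2) * z%:R ^+ 2 + 2 * (z%:R * (q%:R ^+ 2 * N)).
    have t6 : 0 <= 1 + th ^+ 2 by have := sqr_ge0 th; lra.
    apply: le_trans (ler_wpM2l t6 g1) _; rewrite mulrDr; apply: lerD.
      by rewrite mulrA ler_wpM2r ?sqr_ge0 //; have := sqr_ge0 (th ^+ 2); have := sqr_ge0 th; nra.
    apply: ler_wpM2r; first exact: zqN.
    by have := th0; have := th1; nra.
  have MR : 8 * q%:R ^+ 2 * ((3 * q%:R ^+ 2 + 2 * (1 + 4 * q%:R ^+ 2) * c1%:R ^+ 2 * q%:R + 2 * C0%:R) * N) <= M.
    apply: le_trans M_large; rewrite /swap_ratio -/N -!natrX.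
    move: (q ^ 2)%N (c1 ^ 2)%N => Q2 C2; rewrite natrM natrM natrD natrD !natrM natrD natrM.
    by rewrite le_eqVlt; apply/orP; left; apply/eqP; ring.
  set X := (_ + 2 * C0%:R) * N in MR.
  have MR2 : 2 * X <= th ^+ 2 * M.
    have := ler_wpM2l (sqr_ge0 th) MR.
    have -> : th ^+ 2 * (8 * q%:R ^+ 2 * X) = 2 * (4 * q%:R ^+ 2 * th ^+ 2) * X by ring.
    by rewrite t2q mulr1.
  have X0 : 0 <= X.
    apply: mulr_ge0 => //; rewrite -!natrX; move: (q ^ 2)%N (c1 ^ 2)%N => Q2 C2.
    by repeat (first [exact: ler0n | exact: ler01 | apply: addr_ge0 | apply: mulr_ge0]).
  have zt : (2 - 2 * th - 3 / 4 * th ^+ 2) * z%:R <= (2 - 2 * th - 3 / 4 * th ^+ 2) * M.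
    by apply: ler_wpM2l => //; have := th0; have := th1; nra.
  have zX := ler_wpM2l z0 MR2; have zzt := ler_wpM2l z0 zt.
  have zX0 := mulr_ge0 z0 X0.
  have thC : 0 <= th * (z%:R * (C0%:R * N)) by rewrite !mulr_ge0 // ltW.
  have XE : z%:R * X = 3 * (z%:R * (q%:R ^+ 2 * N)) +
     (1 + 4 * q%:R ^+ 2) * (2 * c1%:R ^+ 2 * (q%:R * z%:R * N)) + 2 * (z%:R * (C0%:R * N)).
    by rewrite /X; ring.
  move: usum; rewrite mulrDr => usum.
  apply: le_trans (lerD (lexx _) usum) _.
  apply: le_trans (lerD (lexx _) (lerD e8 (lerD e6 (le_trans e5 e7)))) _.
  have -> : 2 * (1 - th) * z%:R * (M - C0%:R * N) =
    2 * (1 - th) * (z%:R * M) - 2 * (1 - th) * (z%:R * (C0%:R * N)) by ring.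
  exact: swap_arith zX zzt zX0 thC XE.
(* For z = 0 the quantity M - C0 N may vanish and cannot serve as a denominator; both families are
   then empty. *)
have M0 : 0 < M - C0%:R * N \/ z = 0%N.
  case: (posnP z) => [|z1]; [by right|left].
  have a1 : 0 < z%:R :> R by rewrite ltr0n.
  have a2 : 2 * (C0%:R * N) <= M.
    by apply: le_trans M_large; rewrite -/N mulrA -natrM ler_wpM2r // ler_nat swap_ratio_ge.
  have : 1 <= z%:R :> R by rewrite ler1n.
  by have := zM; lra.
case: M0 => [M0|zz0]; last first.
  move: cardF cardF'; rewrite zz0 => /eqP; rewrite cards_eq0 => /eqP F0 /eqP.
  rewrite cards_eq0 => /eqP F0'; rewrite F0 F0' /gwt !big_set0 mulr0 subr0 mulr0.
  rewrite mulr_ge0 ?addr_ge0 ?sqr_ge0 ?sumr_ge0 // => [|? _]; last exact: sqr_ge0.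
  rewrite divr_ge0 // subr_ge0; apply: le_trans M_large; rewrite -/N ler_wpM2r // ler_nat.
  by apply: leq_trans (swap_ratio_ge _); rewrite leq_pmull.
set M' := M - _ in total M0 *.
apply: le_trans (ler_wpM2l xb0 W) _.
(* AM-GM: [xb u |t| <= M'/2 t^2 + xb^2 u^2 / (2 M')] *)
have amgm (w t : R) : xb * (w * `|t|) <= M' / 2 * t ^+ 2 + xb ^+ 2 * w ^+ 2 / (2 * M').
  rewrite -[t ^+ 2]real_normK ?num_real // -subr_ge0.
  have -> : M' / 2 * `|t| ^+ 2 + xb ^+ 2 * w ^+ 2 / (2 * M') - xb * (w * `|t|) =
    (M' * `|t| - xb * w) ^+ 2 / (2 * M') by field; rewrite gt_eqF.
  by rewrite divr_ge0 ?sqr_ge0 // mulr_ge0 // ltW.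
have hs : xb * (\sum_(i in V) u i * `|y i|) <=
   M' / 2 * psum y V 2 + xb ^+ 2 * (\sum_(i in V) u i ^+ 2) / (2 * M').
  rewrite mulr_sumr /psum mulr_sumr mulr_sumr mulr_suml -big_split /=.
  by apply: ler_sum => i _; apply: amgm.
have ha := amgm ((1 - th) * z%:R) ya.
have ht : xb ^+ 2 * ((1 - th) * z%:R) ^+ 2 / (2 * M') + xb ^+ 2 * (\sum_(i in V) u i ^+ 2) / (2 * M') <=
   (1 - th) * z%:R * xb ^+ 2.
  rewrite -mulrDl -mulrDr ler_pdivrMr ?mulr_gt0 //.
  have := ler_wpM2l (sqr_ge0 xb) total; rewrite exprMn; lra.
have -> : xb * (- (1 - th) * z%:R * xb + (1 - th) * z%:R * `|ya| + \sum_(i in V) u i * `|y i|) =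
  - ((1 - th) * z%:R * xb ^+ 2) + xb * ((1 - th) * z%:R * `|ya|) + xb * (\sum_(i in V) u i * `|y i|).
  by ring.
lra.
Qed.

End PairSwap.

(** * Support of size n + 1 *)

Section LightestPair.
Variables (R : realFieldType) (T : finType) (s n W : nat).
Let r := s.+3.
Variables (x : T -> R) (A : {set T}) (G : {set {set T}}) (a b : T).
Hypotheses (x0 : forall i, 0 <= x i).
Hypotheses (cardA : #|A| = n.+1) (sumA : \sum_(i in A) x i = n%:R) (n_gt0 : (0 < n)%N).
Hypotheses (aA : a \in A) (bA : b \in A) (aNb : a != b).
Hypotheses (b_min : {in A, forall i, x b <= x i}).
Hypotheses (a_min : {in A, forall i, i != b -> x a <= x i}).
Hypothesis GA : G \subset draws A r.
Hypothesis cardG : (#|G| <= 'C(n, r) + 'C(n.-1, s.+2))%N.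
Hypothesis var : psum (fun i => x i - 1) A 2 <= W%:R.

Implicit Types (H : {set {set T}}) (e f : {set T}).
Let V := A :\ b :\ a.
(* Deviation from 1 of the weighting in which b is merged into a. *)
Definition merged i : R := if i == a then x a + x b - 1 else x i - 1.
Let w := merged.
Let M := 'C(n.-1, s.+1).

Let aA1 : a \in A :\ b. Proof. by rewrite !inE aNb. Qed.

Lemma mergedV i : i \in V -> 1 + w i = x i.
Proof. by rewrite !inE /w /merged => /and3P[/negbTE -> _ _]; rewrite addrC subrK. Qed.

Lemma card_V : #|V| = n.-1.
Proof.
have := cardsD1 b A; rewrite bA cardA add1n => -[E].
by have := cardsD1 a (A :\ b); rewrite aA1 add1n -E -/V => ->.
Qed.

Lemma gwt_merged H j : H \subset draws V j -> gwt (fun i => 1 + w i) H = gwt x H.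
Proof.
move=> /subsetP HV; apply: eq_bigr => e /HV; rewrite inE => /andP[/subsetP eV _].
by apply: eq_mon => i /eV; exact: mergedV.
Qed.

Lemma xb_le1 : x b <= 1.
Proof.
have h : \sum_(i in A) x b <= \sum_(i in A) x i by apply: ler_sum => i; exact: b_min.
move: h; rewrite sumr_const cardA sumA -[x b *+ _]mulr_natl -natr1 => h.
have n0 : 0 < n%:R :> R by rewrite ltr0n.
rewrite -(ler_pM2l n0); have := x0 b; lra.
Qed.

Lemma xa_le1 : x a <= 1.
Proof.
have h : \sum_(i in A :\ b) x a <= \sum_(i in A :\ b) x i.
  by apply: ler_sum => i; rewrite !inE => /andP[ib iA]; exact: a_min.
have E : #|A :\ b| = n by have := cardsD1 b A; rewrite bA cardA add1n => -[->].
have S : \sum_(i in A :\ b) x i <= n%:R.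
  by rewrite -sumA [leRHS](big_setD1 b bA) /= lerDr.
have n0 : 0 < n%:R :> R by rewrite ltr0n.
by move: (le_trans h S); rewrite sumr_const E -[x a *+ _]mulr_natr -{2}[n%:R]mul1r ler_pM2r.
Qed.

(** Sets containing exactly one of a and b contribute linearly in x a and x b, so they see only the
    sum x a + x b, which the merged vertex carries. *)
Lemma elsym_pair : elsym x A r =
  elsym (fun i => 1 + w i) (A :\ b) r + x a * x b * elsym x V s.+1.
Proof.
have EV j : elsym (fun i => 1 + w i) V j = elsym x V j by apply: eq_esym; exact: mergedV.
rewrite /r (elsym_rec x _ bA) (elsym_rec x _ aA1) (elsym_rec x s.+1 aA1).
rewrite (elsym_rec (fun i => 1 + w i) _ aA1) -/V !EV /w /merged eqxx; ring.
Qed.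

Let P := [set e in draws A r | (a \in e) && (b \in e)].
Let Z := G :&: P.
Let Y := (draws A r :\: G) :\: P.

Lemma P_sub : P \subset draws A r.
Proof. by apply/subsetP => e; rewrite inE => /andP[]. Qed.

Lemma link_pair H : H \subset P -> link (link H b) a \subset draws V s.+1.
Proof.
move=> HP; apply: link_draws; apply: link_draws.
exact: subset_trans HP P_sub.
Qed.

Lemma pair_mem H : H \subset P ->
  (forall e, e \in H -> b \in e) /\ (forall e, e \in link H b -> a \in e).
Proof.
move=> /subsetP HP; split=> e; first by move=> /HP; rewrite inE => /and3P[].
rewrite inE => /andP[_ /HP]; rewrite inE => /and3P[_]; rewrite in_setU1.
by rewrite (negbTE aNb).
Qed.

Lemma gwt_pair H : H \subset P -> gwt x H = x b * (x a * gwt x (link (link H b) a)).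
Proof. by move=> /pair_mem[h1 h2]; rewrite (gwt_link_all x h1) (gwt_link_all x h2). Qed.

Lemma card_pair H : H \subset P -> #|link (link H b) a| = #|H|.
Proof. by move=> /pair_mem[h1 h2]; rewrite (card_link_all h2) (card_link_all h1). Qed.

Lemma link_P : link (link P b) a = draws V s.+1.
Proof.
apply/eqP; rewrite eqEsubset link_pair //=; apply/subsetP => e; rewrite inE => /andP[eV /eqP ec].
have /andP[ae be] : (a \notin e) && (b \notin e).
  by move: eV; rewrite !subsetD1 -andbA => /and3P[_ -> ->].
have be' : b \notin a |: e by rewrite in_setU1 negb_or eq_sym aNb be.
rewrite in_set ae in_set be' /= in_set !in_setU1 !eqxx !orbT !andbT in_set.
rewrite !subUset !sub1set aA bA /= !cardsU1 be' ae ec eqxx andbT.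
by apply: subset_trans eV _; exact: subset_trans (subsetDl _ _) (subsetDl _ _).
Qed.

Lemma card_P : #|P| = M.
Proof. by rewrite -(card_pair (subxx P)) link_P card_draws_set card_V. Qed.

Lemma Z_sub : Z \subset P. Proof. exact: subsetIr. Qed.

Lemma card_Z_le : (#|Z| <= M)%N.
Proof. by rewrite -card_P subset_leq_card // Z_sub. Qed.

Lemma miss_split : draws A r :\: G = (P :\: Z) :|: Y.
Proof.
apply/setP => e; rewrite !in_setU !in_setD in_setI.
have : (e \in P) -> (e \in draws A r) by apply/subsetP/P_sub.
by case: (e \in P) => [->|_] //; case: (e \in G); case: (e \in draws A r).
Qed.

(** By Pascal's rule twice, at least ['C(n.+1, r)] - ['C(n, r)] - ['C(n.-1, s.+2)] = M = #|P| sets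
    are missing, and those that contain both a and b number only #|P| - #|Z|. *)
Lemma card_Y : (#|Z| <= #|Y|)%N.
Proof.
have h1 : (#|draws A r :\: G| <= #|P :\: Z| + #|Y|)%N by rewrite miss_split leq_card_setU.
move: h1; rewrite !cardsD (setIidPr GA) (setIidPr Z_sub) card_draws_set cardA card_P.
have B1 : 'C(n.+1, r) = ('C(n, r) + 'C(n, s.+2))%N by exact: binS.
have B2 : 'C(n, s.+2) = ('C(n.-1, s.+2) + 'C(n.-1, s.+1))%N.
  by rewrite -{1}(prednK n_gt0) binS.
by have := cardG; have := card_Z_le; rewrite /M B1 B2; lia.
Qed.

Lemma gwt_pair_split :
  gwt x G = elsym (fun i => 1 + w i) (A :\ b) r + gwt x Z - gwt x Y.
Proof.
have e1 := gwt_setD x GA.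
have e2 : gwt x (draws A r :\: G) = gwt x (P :\: Z) + gwt x Y.
  rewrite (gwt_setD x (_ : P :\: Z \subset draws A r :\: G)); last first.
    by rewrite miss_split subsetUl.
  congr (_ + gwt x _); apply/setP => e; rewrite !in_setD in_setI.
  by case: (e \in P); case: (e \in G).
have e3 := gwt_setD x Z_sub.
have e4 : gwt x P = x a * x b * elsym x V s.+1.
  by rewrite (gwt_pair (subxx P)) link_P elsym_gwt; ring.
have := elsym_pair; rewrite elsym_gwt; lra.
Qed.

Let Q := w a ^+ 2 + psum w V 2.

Let rho := (2 * W + 2)%N.

(** At the merged vertex (x a - 1 + x b)^2 <= 2 (x a - 1)^2 + 2 (x b)^2 with x b <= 1, whence the
    bound 2 W + 2. *)
Lemma Q_le : Q <= rho%:R.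
Proof.
have e1 : psum (fun i => x i - 1) A 2 = (x b - 1) ^+ 2 + ((x a - 1) ^+ 2 + psum w V 2).
  rewrite /psum (big_setD1 b bA) /= (big_setD1 a aA1) /= -/V; congr (_ + (_ + _)).
  by apply: eq_bigr => i iV; rewrite -(mergedV iV); congr (_ ^+ _); ring.
have p0 : 0 <= psum w V 2 by apply: sumr_ge0 => ? _; exact: sqr_ge0.
have := var; rewrite e1 /Q /w /merged eqxx /rho natrD natrM.
have := xb_le1; have := x0 b; have := sqr_ge0 (x a - 1 - x b); have := sqr_ge0 (x b - 1).
nra.
Qed.

Lemma Q_ge0 : 0 <= Q.
Proof. by rewrite addr_ge0 ?sqr_ge0 // sumr_ge0 // => ? _; exact: sqr_ge0. Qed.

(** The 1 pays for replacing ['C(n - 2, s.+1)] by M, the rest for the terms of order three and more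
    in [elsym_near_uniform]. *)
Definition pair_loss := (1 + 2 * s.+1 * rho)%N.

Lemma elsym_merged_le : (rho <= n)%N -> elsym (fun i => 1 + w i) (A :\ b) r <=
  'C(n, r)%:R - Q / 2 * (M%:R - pair_loss%:R * n%:R ^+ s).
Proof.
move=> rn.
have E : #|A :\ b| = n by have := cardsD1 b A; rewrite bA cardA add1n => -[->].
have QE : psum w (A :\ b) 2 = Q by rewrite /psum (big_setD1 a aA1).
have w1 : \sum_(i in A :\ b) w i = 0.
  rewrite (big_setD1 a aA1) /= -/V.
  have -> : \sum_(i in V) w i = \sum_(i in V) x i - n.-1%:R.
    rewrite -card_V -sum1_card natr_sum -sumrB; apply: eq_bigr => i iV.
    by rewrite -(mergedV iV); ring.
  have := sumA; rewrite (big_setD1 b bA) /= (big_setD1 a aA1) /= -/V.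
  have -> : n%:R = n.-1%:R + 1 :> R by rewrite natr1 prednK.
  by rewrite /w /merged eqxx; lra.
have rR : Q <= rho%:R ^+ 2.
  by apply: le_trans Q_le _; rewrite -natrX ler_nat expnS expn1 leq_pmulr // /rho addn2.
have := @elsym_near_uniform _ _ w (A :\ b) n s rho%:R E _ w1; rewrite QE.
move=> /(_ _ rR); rewrite ler0n ler_nat rn => /(_ isT) h; apply: le_trans h _.
have bl : M%:R - n%:R ^+ s <= 'C(n - 2, s.+1)%:R :> R.
  rewrite lerBlDr -natrX -natrD ler_nat /M.
  have -> : (n - 2 = n.-1.-1)%N by lia.
  move: n_gt0; case: (n) => [//|[|m]] _ /=; first by rewrite bin_small // bin0n.
  rewrite binS leq_add2l; apply: leq_trans (bin_le_expn _ _) _.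
  by case: (s) => // k; rewrite leq_exp2r //; lia.
have N0 : 0 <= n%:R ^+ s :> R by rewrite exprn_ge0.
have := ler_wpM2l Q_ge0 bl.
rewrite /pair_loss natrD !natrM; lra.
Qed.


Hypothesis opt : forall e f, e \in G -> f \in draws A r :\: G -> mon x f <= mon x e.
Let L := swap_prec s.
Let q := s.+2.
Let c2 := (2 ^ q * q)%N.
Let L0 : 0 < L%:R :> R. Proof. by rewrite ltr0n swap_prec_gt0. Qed.

Lemma w_sqr_le i : i \in A :\ b -> w i ^+ 2 <= Q.
Proof.
move=> iA; rewrite /Q; case: (eqVneq i a) => [->|ia].
  by rewrite lerDl sumr_ge0 // => ? _; exact: sqr_ge0.
have iV : i \in V by rewrite in_setD1 ia.
rewrite /psum (big_setD1 i iV) /= addrCA lerDl addr_ge0 ?sqr_ge0 // sumr_ge0 // => ? _.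
exact: sqr_ge0.
Qed.

Let c2L : c2%:R / L%:R <= 8^-1 :> R.
Proof.
rewrite ler_pdivrMr // mulrC ler_pdivlMr // -natrM ler_nat; apply: leq_trans (swap_prec_ge s).
by rewrite mulnC leq_mul2r orbT.
Qed.

Let V_A1 i : i \in V -> i \in A :\ b. Proof. by rewrite [i \in V]in_setD1 => /andP[]. Qed.

(** * The pair case when all merged weights are close to 1 *)

Section Small.
Hypothesis Q_small : Q * L%:R ^+ 2 <= 1.

Lemma w_small i : i \in A :\ b -> `|w i| <= L%:R^-1.
Proof.
move=> iA; rewrite -(ler_pXn2r (n:=2)) ?nnegrE ?invr_ge0 ?(ltW L0) //.
rewrite real_normK ?num_real // exprVn; apply: le_trans (w_sqr_le iA) _.
by rewrite -[leRHS]mul1r ler_pdivlMr ?exprn_gt0.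
Qed.

Let L01 : 0 <= (L%:R^-1 : R) <= 1.
Proof. by rewrite invr_ge0 ler0n invf_le1 // ler1n swap_prec_gt0. Qed.

Lemma mon_near1 e : e \subset V -> (#|e| <= q)%N -> `|mon x e - 1| <= 8^-1.
Proof.
move=> /subsetP eV eq.
have -> : mon x e = mon (fun i => 1 + w i) e.
  by apply: eq_mon => i /eV iV; rewrite mergedV.
have := @prod_dev0 _ _ w L%:R^-1 e L01 (fun i ie => w_small (V_A1 (eV i ie))).
move=> h; apply: le_trans h _; apply: le_trans c2L.
rewrite ler_wpM2r ?invr_ge0 ?(ltW L0) // ler_nat leq_mul // leq_exp2l //.
Qed.

(** An edge through a and b weighs about x a x b, while a missing set avoiding b weighs at least
    about x a. Optimality of G then forces x b >= 7/9, hence x a + x b >= 14/9, although the merged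
    weight x a + x b is at most 9/8. *)
Lemma missing_at_b e f : e \in Z -> f \in Y -> b \in f.
Proof.
move=> eZ; rewrite in_setD => /andP[fP fM]; apply/negPn/negP => bf.
have [fA /eqP fr] : f \subset A /\ #|f| == r.
  by move: fM; rewrite in_setD in_set => /and3P[].
have fA1 : f \subset A :\ b by rewrite subsetD1 fA.
have eG : e \in G by move: eZ; rewrite in_setI => /andP[].
have := opt eG fM.
have wa := w_small aA1; move: wa; rewrite /w /merged eqxx ler_norml => /andP[wa1 wa2].
have Li : L%:R^-1 <= 8^-1 :> R.
  rewrite lef_pV2 ?posrE // ler_nat; apply: leq_trans (swap_prec_ge s).
  by apply: (@leq_trans (16 * 1)) => //; rewrite leq_mul2l muln_gt0 expn_gt0.
have ab : x b <= x a by apply: b_min.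
(* Only vertices of V are known to have weight near 1, so a is split off when it lies in f;
   otherwise any vertex of f will do. *)
have [v [vf va fv]] : exists v, [/\ v \in f, x a <= x v & f :\ v \subset V].
  case: (boolP (a \in f)) => af.
    by exists a; split => //; apply: setSD.
  have /set0Pn[v vf] : f != set0 by rewrite -card_gt0 fr.
  exists v; split => //.
    apply: a_min; first exact: (subsetP fA).
    by apply: contraNneq bf => <-.
  by rewrite subsetD1; apply/andP; split; [apply: subset_trans fA1; exact: subsetDl|rewrite !inE (negbTE af) andbF].
have h1 : `|mon x (f :\ v) - 1| <= 8^-1.
  by apply: mon_near1 => //; have := cardsD1 v f; rewrite vf fr add1n => -[<-].
have [e' [e'V eE]] : exists e', e' \in draws V s.+1 /\ mon x e = x b * (x a * mon x e').
  have : e \in P by apply: (subsetP Z_sub).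
  have [h1' h2'] := pair_mem (subxx P).
  move=> eP; have be := h1' _ eP.
  have el : e :\ b \in link P b by rewrite in_set setD11 /= setD1K.
  have ae := h2' _ el; exists (e :\ b :\ a); rewrite -link_P; split.
    by rewrite in_set setD11 /= setD1K.
  by rewrite (mon_setD1 x be) (mon_setD1 x ae).
have h2 : `|mon x e' - 1| <= 8^-1.
  by move: e'V; rewrite in_set => /andP[eV /eqP ec]; apply: mon_near1; rewrite ?ec.
rewrite (mon_setD1 x vf) eE.
move: h1 h2; rewrite !ler_norml => /andP[h1 _] /andP[_ h2] h3.
have xa0 : 0 < x a by lra.
have h4 : x a * (7 / 8) <= x v * mon x (f :\ v) by apply: ler_pM => //; lra.
have h5 : x b * (x a * mon x e') <= x b * (x a * (9 / 8)).
  by rewrite ler_wpM2l // ler_wpM2l //; lra.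
have : x a * (7 / 8) <= x a * (x b * (9 / 8)) by lra.
rewrite ler_pM2l //; lra.
Qed.

(** If Z is nonempty, every set of Y contains b, so gain and loss share the factor x b. As #|Z| <=
    #|Y|, the link of Y at b contains a family F of size #|Z|, and [swap_bound] compares it with the
    link of Z at b and a. *)
Lemma pair_small : (swap_ratio s pair_loss)%:R * n%:R ^+ s <= M%:R :> R -> (1 < n)%N ->
  gwt x Z - gwt x Y <= Q / 2 * (M%:R - pair_loss%:R * n%:R ^+ s).
Proof.
move=> ML n1.
have ML' : pair_loss%:R * n%:R ^+ s <= M%:R :> R.
  apply: le_trans ML; rewrite ler_wpM2r ?exprn_ge0 // ler_nat.
  by apply: leq_trans (swap_ratio_ge _ _); rewrite leq_pmull.
case: (set_0Vmem Z) => [Z0|[e eZ]].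
  rewrite Z0 /gwt big_set0 sub0r; apply: (@le_trans _ _ 0).
    by rewrite oppr_le0 gwt_ge0.
  by rewrite mulr_ge0 ?divr_ge0 ?Q_ge0 // subr_ge0.
have Yb f : f \in Y -> b \in f by apply: missing_at_b eZ.
have : (0 < #|draws (link Y b) #|Z| |)%N.
  by rewrite card_draws_set bin_gt0 (card_link_all Yb) card_Y.
rewrite card_gt0 => /set0Pn[F]; rewrite in_set => /andP[FY /eqP cF].
have FV : F \subset draws V q.
  apply: subset_trans FY _; apply/subsetP => f fY.
  have : f \in draws (A :\ b) q.
    apply: (subsetP (link_draws b (_ : Y \subset draws A r))) => //.
    by apply/subsetP => g; rewrite !in_setD => /and3P[].
  rewrite !in_set => /andP[fA ->]; rewrite subsetD1 fA andbT /=.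
  move: fY; rewrite in_set => /andP[_]; rewrite !in_setD in_set setU11 andbT in_setU1.
  by rewrite (negbTE aNb) /= => /and3P[h _ hd]; move: h; rewrite hd.
have FV' := link_pair Z_sub.
have sw := @swap_bound R T s L n pair_loss w V F (link (link Z b) a) M%:R (x a) (x b) (w a) #|Z|
   (leqnn _) _ FV FV' cF (card_pair Z_sub) (fun i iV => w_small (V_A1 iV)) (x0 b) (x0 a) xa_le1.
rewrite (gwt_pair Z_sub) (gwt_link_all x Yb).
have : x b * gwt x F <= x b * gwt x (link Y b) by rewrite ler_wpM2l // gwt_le.
move: sw; rewrite (gwt_merged FV) (gwt_merged FV') -/Q => sw.
suff : x b * (x a * gwt x (link (link Z b) a) - gwt x F) <= (M%:R - pair_loss%:R * n%:R ^+ s) / 2 * Q.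
  by lra.
apply: sw => //.
- by rewrite card_V -subn1 subn_gt0 n1 leq_subr.
- by rewrite /w /merged eqxx; ring.
- move=> i iV; rewrite mergedV //; move: iV; rewrite !in_setD1 => /and3P[_ ib iA].
  exact: a_min.
- by rewrite ler_nat card_Z_le.
Qed.

End Small.

(** * The pair case when Q is bounded below *)

Section Large.
Variable K : nat.
Hypothesis xK : forall i, x i <= K%:R.
(** Precision at which an error of [c2] / L' per edge, over at most M edges, is small against Q M
    when Q >= 1 / L^2. *)
Let L' := (16 * c2 * L ^ 2)%N.
Let eps : R := L'%:R^-1.
Let sg := (L' ^ 2 * rho + 2)%N.
Let bad := [set i in V | eps < `|w i|].
Let S := [set a; b] :|: bad.

Definition pair_error := (8 * L ^ 2 * (sg * K ^ s.+1 + sg ^ 3) + 2 * pair_loss)%N.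

Let c20 : (0 < c2)%N. Proof. by rewrite muln_gt0 expn_gt0. Qed.

Let L'0 : (0 < L')%N.
Proof. by rewrite muln_gt0 (expn_gt0 L) swap_prec_gt0 muln_gt0 c20. Qed.

Let eps01 : 0 <= eps <= 1.
Proof. by rewrite invr_ge0 ler0n invf_le1 ?ltr0n // ler1n. Qed.

Let eps_gt0 : 0 < eps. Proof. by rewrite invr_gt0 ltr0n. Qed.

Let c2eps : c2%:R * eps * (8 * L%:R ^+ 2) = 2^-1.
Proof.
have Ln : L%:R != 0 :> R by rewrite gt_eqF.
have cn : c2%:R != 0 :> R by rewrite pnatr_eq0 -lt0n.
rewrite /eps /L' natrM natrM natrX; move: (c2%:R) (L%:R) cn Ln => u v cn Ln.
by field; rewrite Ln cn.
Qed.

Lemma card_badV : (#|bad| <= L' ^ 2 * rho)%N.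
Proof.
rewrite -(ler_nat R).
have h : #|bad|%:R * eps ^+ 2 <= Q.
  apply: (@le_trans _ _ (psum w V 2)); last by rewrite /Q lerDr sqr_ge0.
  rewrite mulr_natl -sumr_const /psum [leRHS](big_setID bad) /=.
  have -> : V :&: bad = bad by apply/setIidPr/subsetP => v; rewrite in_set => /andP[].
  rewrite -[leLHS]addr0; apply: lerD; last by apply: sumr_ge0 => ? _; exact: sqr_ge0.
  apply: ler_sum => v; rewrite in_set => /andP[_ xv]; rewrite -[w v ^+ 2]real_normK ?num_real //.
  by apply: lerXn2r; rewrite ?nnegrE // ltW.
have := le_trans h Q_le; rewrite exprVn ler_pdivrMr ?exprn_gt0 ?ltr0n //.
by rewrite natrM natrX mulrC.
Qed.

Lemma card_S : (#|S| <= sg)%N.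
Proof.
apply: leq_trans (leq_card_setU _ _) _.
by rewrite /sg addnC leq_add ?card_badV // cards2 aNb.
Qed.

Lemma mon_good e : e \subset V -> [disjoint e & bad] -> (#|e| <= q)%N ->
  `|mon x e - 1| <= c2%:R * eps.
Proof.
move=> /subsetP eV dis eq.
have -> : mon x e = mon (fun i => 1 + w i) e.
  by apply: eq_mon => i /eV iV; rewrite mergedV.
have we : {in e, forall i, `|w i| <= eps}.
  move=> i ie; rewrite leNgt; apply/negP => wi.
  by move/disjoint_setI0/setP: dis => /(_ i); rewrite in_setI ie [i \in bad]in_set eV // wi in_set0.
apply: le_trans (prod_dev0 eps01 we) _.
by rewrite ler_wpM2r ?(ltW eps_gt0) // ler_nat leq_mul // leq_exp2l.
Qed.

(** Away from [bad], an edge of Z weighs nearly x a x b. Those meeting [bad] number at most [sg]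
    n^s, and their s + 1 further vertices weigh at most K each. *)
Lemma gwt_Z_le : gwt x Z <= x a * x b * #|Z|%:R + c2%:R * eps * #|Z|%:R +
  (sg * K ^ s.+1)%:R * n%:R ^+ s.
Proof.
rewrite (gwt_pair Z_sub); set F := link _ a.
have FV : F \subset draws V s.+1 := link_pair Z_sub.
have cF : #|F| = #|Z| := card_pair Z_sub.
have h1 : gwt x F <= #|Z|%:R + c2%:R * eps * #|Z|%:R +
    K%:R ^+ s.+1 * #|[set e in F | ~~ [disjoint e & bad]]|%:R.
  set B := [set e in F | _].
  have BF : B \subset F by apply/subsetP => e; rewrite in_set => /andP[].
  rewrite (gwt_setD x BF) addrC; apply: lerD.
    apply: (@le_trans _ _ ((1 + c2%:R * eps) * #|F :\: B|%:R)).
      apply: gwt_le_card => e; rewrite in_setD in_set => /andP[eB eF].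
      have dis : [disjoint e & bad] by move: eB; rewrite eF negbK.
      have := subsetP FV _ eF; rewrite in_set => /andP[eV /eqP ec].
      have := mon_good eV dis; rewrite ec => /(_ (leqnSn _)); rewrite ler_norml => /andP[_].
      by rewrite lerBlDl.
    rewrite mulrDl mul1r -cF; have hc : #|F :\: B|%:R <= #|F|%:R :> R.
      by rewrite ler_nat subset_leq_card // subsetDl.
    by apply: lerD => //; rewrite ler_wpM2l // mulr_ge0 // ltW.
  apply: gwt_le_card => e; rewrite in_set => /andP[eF _].
  have := subsetP FV _ eF; rewrite in_set => /andP[eV /eqP ec].
  by rewrite -ec -prodr_const; apply: ler_prod => i _; rewrite x0 xK.
have h2 : (#|[set e in F | ~~ [disjoint e & bad]]| <= sg * n ^ s)%N.
  apply: leq_trans (card_meet _ _) _.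
  apply: (@leq_trans (\sum_(v in bad) n ^ s)%N).
    apply: leq_sum => v _; apply: leq_trans (subset_leq_card (link_draws v FV)) _.
    rewrite card_draws_set; apply: leq_trans (bin_le_expn _ _) _.
    case: (s) => // k; rewrite leq_exp2r //; apply: leq_trans (subset_leq_card (subsetDl _ _)) _.
    by rewrite card_V leq_pred.
  rewrite sum_nat_const leq_mul2r; apply/orP; right.
  by apply: leq_trans card_badV _; rewrite /sg leq_addr.
have xab : 0 <= x a * x b <= 1.
  by rewrite mulr_ge0 //= mulr_ile1 ?xa_le1 ?xb_le1.
case/andP: xab => ab0 ab1.
have h3 : K%:R ^+ s.+1 * #|[set e in F | ~~ [disjoint e & bad]]|%:R <=
    (sg * K ^ s.+1)%:R * n%:R ^+ s :> R.
  rewrite mulnC natrM natrX -mulrA ler_wpM2l ?exprn_ge0 // -natrX -natrM ler_nat.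
  exact: h2.
have e0 : 0 <= c2%:R * eps * #|Z|%:R by rewrite !mulr_ge0 // ltW.
have k0 : 0 <= (sg * K ^ s.+1)%:R * n%:R ^+ s :> R by rewrite mulr_ge0 ?exprn_ge0.
rewrite mulrA [x b * x a]mulrC; apply: le_trans (ler_wpM2l ab0 (le_trans h1 (lerD (lexx _) h3))) _.
move: ab0 ab1 e0 k0; move: (x a * x b) (c2%:R * eps * _) (_ * n%:R ^+ s) => u v t *.
rewrite !mulrDr -addrA -[leRHS]addrA lerD2l; apply: lerD; exact: ler_piMl.
Qed.

Lemma mon_pair (p : {set T}) : p \subset A -> #|p| = 2 -> x a * x b <= mon x p.
Proof.
move=> pA /eqP/cards2P[i [j [ij pE]]]; move: pA; rewrite pE subUset !sub1set => /andP[iA jA].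
rewrite /mon big_setU1 ?in_set1 //= big_set1.
case: (eqVneq i b) => [ib|ib]; last first.
  by apply: ler_pM => //; [exact: a_min | exact: b_min].
rewrite mulrC; apply: ler_pM => //; rewrite ?ib //.
by apply: a_min => //; rewrite -ib eq_sym.
Qed.

(** A set meeting S in at most two vertices contains a pair p covering that intersection. The pair
    weighs at least x a x b because a and b are lightest, and the remaining vertices have weight
    near 1. Sets meeting S in three vertices number at most [sg]^3 n^s, and #|Z| <= #|Y| does the
    rest. *)
Lemma gwt_Y_ge : x a * x b * #|Z|%:R - c2%:R * eps * #|Z|%:R - (sg ^ 3)%:R * n%:R ^+ s <= gwt x Y.
Proof.
pose D := [set e in Y | (3 <= #|e :&: S|)%N].
have YA e : e \in Y -> e \in draws A r by rewrite !in_setD => /and3P[].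
have SA : S \subset A.
  rewrite !subUset !sub1set aA bA /=; apply/subsetP => i; rewrite in_set => /andP[iV _].
  by move: iV; rewrite !in_setD1 => /and3P[].
have hD : (#|D| <= sg ^ 3 * n ^ s)%N.
  apply: (@leq_trans (\sum_(e in D) \sum_(p in draws S 3 | p \subset e) 1)%N).
    rewrite -sum1_card; apply: leq_sum => e; rewrite in_set => /andP[_ e3].
    have : (0 < #|draws (e :&: S) 3|)%N by rewrite card_draws_set bin_gt0.
    rewrite card_gt0 => /set0Pn[p]; rewrite in_set subsetI => /andP[/andP[pe pS] pc].
    by rewrite (bigD1 p) //= in_set pS pc pe.
  rewrite (exchange_big_dep (fun p => p \in draws S 3)) /=; last by move=> ? ? _ /andP[].
  apply: (@leq_trans (\sum_(p in draws S 3) n ^ s)%N).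
    apply: leq_sum => p pS; rewrite sum1dep_card.
    have /andP[pS1 /eqP pc] : (p \subset S) && (#|p| == 3) by move: pS; rewrite in_set.
    apply: (@leq_trans #|[set e : {set T} | [&& e \subset A, #|e| == r & p \subset e]]|).
      apply: subset_leq_card; apply/subsetP => e; rewrite [in X in X -> _]in_set.
      move=> /andP[eD /andP[_ pe]]; move: eD; rewrite [e \in D]in_set => /andP[/YA + _].
      by rewrite !in_set pe andbT.
    rewrite card_subsets ?pc //; last exact: subset_trans SA.
    rewrite cardA /r !subSS subn0; apply: leq_trans (bin_le_expn _ _) _.
    by case: (s) => // k; rewrite leq_exp2r // leq_subr.
  rewrite sum_nat_const leq_mul2r card_draws_set; apply/orP; right.
  by apply: leq_trans (bin_le_expn _ _) _; rewrite leq_exp2r // card_S.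
set be := x a * x b * (1 - c2%:R * eps).
have c2e1 : c2%:R * eps <= 1.
  have := c2eps; have : 1 <= L%:R ^+ 2 :> R by rewrite exprn_ege1 // ler1n swap_prec_gt0.
  have : 0 <= c2%:R * eps by rewrite mulr_ge0 // ltW.
  move: (c2%:R * eps) (L%:R ^+ 2) => u v; nra.
have xab : 0 <= x a * x b <= 1.
  by rewrite mulr_ge0 //= mulr_ile1 ?xa_le1 ?xb_le1.
case/andP: xab => ab0 ab1.
have be0 : 0 <= be by rewrite mulr_ge0 // subr_ge0.
have be1 : be <= 1.
  by rewrite mulr_ile1 // ?subr_ge0 // gerBl mulr_ge0 // ltW.
have hgood e : e \in Y :\: D -> be <= mon x e.
  rewrite in_setD => /andP[eD eY]; move: eD; rewrite in_set eY /= -ltnNge ltnS => eS.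
  have := YA _ eY; rewrite in_set => /andP[eA /eqP ec].
  have [|p [Sp pe pc]] := @exists_between T (e :&: S) e 2 (subsetIl _ _).
    by rewrite eS ec.
  have -> : mon x e = mon x p * mon x (e :\: p).
    by rewrite /mon (big_setID p) /= (setIidPr pe).
  have eSp : [disjoint e :\: p & S].
    rewrite -setI_eq0; apply/eqP/setP => i; rewrite !in_setI in_setD in_set0.
    case: (boolP (i \in e)) => //= ie; last by rewrite andbF.
    case: (boolP (i \in S)) => //= iS; last by rewrite andbF.
    by rewrite (subsetP Sp) // in_setI ie iS.
  have epV : e :\: p \subset V.
    apply/subsetP => i iep; have iA : i \in A.
      by apply: (subsetP eA); move: iep; rewrite in_setD => /andP[].
    have : i \notin S by apply/negP => iS; move/disjoint_setI0/setP: eSp => /(_ i); rewrite in_setI iep iS in_set0.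
    by rewrite in_setU in_set2 !negb_or => /andP[/andP[ia ib] _]; rewrite !in_setD1 ia ib.
  have epb : [disjoint e :\: p & bad].
    by apply: disjointWr eSp; exact: subsetUr.
  have epc : (#|e :\: p| <= q)%N.
    by rewrite cardsD (setIidPr pe) ec pc !subSS subn0.
  have := mon_good epV epb epc; rewrite ler_norml => /andP[h _].
  apply: ler_pM => //; [by rewrite subr_ge0 | apply: mon_pair => // | lra].
  exact: subset_trans eA.
have DY : D \subset Y by apply/subsetP => e; rewrite in_set => /andP[].
have h1 : be * #|Y :\: D|%:R <= gwt x Y.
  apply: (@le_trans _ _ (gwt x (Y :\: D))); last by apply: gwt_le => //; exact: subsetDl.
  exact: gwt_ge_card.
have h2 : #|Z|%:R <= #|Y :\: D|%:R + (sg ^ 3)%:R * n%:R ^+ s :> R.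
  rewrite -natrX -natrM -natrD ler_nat cardsD (setIidPr DY).
  apply: leq_trans card_Y _; rewrite -{1}(subnK (subset_leq_card DY)) leq_add2l //.
have h3 := ler_wpM2l be0 h2.
have s0 : 0 <= (sg ^ 3)%:R * n%:R ^+ s :> R by rewrite mulr_ge0 ?exprn_ge0.
have h4 : be * ((sg ^ 3)%:R * n%:R ^+ s) <= (sg ^ 3)%:R * n%:R ^+ s by apply: ler_piMl.
have h5 : x a * x b * (c2%:R * eps * #|Z|%:R) <= c2%:R * eps * #|Z|%:R.
  by apply: ler_piMl => //; rewrite !mulr_ge0 // ltW.
have h6 : be * #|Z|%:R = x a * x b * #|Z|%:R - x a * x b * (c2%:R * eps * #|Z|%:R) by rewrite /be; ring.
lra.
Qed.

(** The main terms x a x b #|Z| cancel. What remains is M / (8 L^2) + O(n^s), while the allowed loss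
    is about Q M / 2 >= M / (2 L^2). *)
Lemma pair_large : 1 <= Q * L%:R ^+ 2 -> pair_error%:R * n%:R ^+ s <= M%:R :> R ->
  gwt x Z - gwt x Y <= Q / 2 * (M%:R - pair_loss%:R * n%:R ^+ s).
Proof.
move=> Q1 ME; have hZ := gwt_Z_le; have hY := gwt_Y_ge.
have N0 : 0 <= n%:R ^+ s :> R by rewrite exprn_ge0.
set E1 := (sg * K ^ s.+1)%:R * n%:R ^+ s in hZ; set E2 := (sg ^ 3)%:R * n%:R ^+ s in hY.
have E10 : 0 <= E1 by rewrite mulr_ge0.
have E20 : 0 <= E2 by rewrite mulr_ge0.
have ME' : 8 * L%:R ^+ 2 * (E1 + E2) + 2 * (pair_loss%:R * n%:R ^+ s) <= M%:R.
  apply: le_trans ME; rewrite /pair_error /E1 /E2.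
  move: (sg * K ^ s.+1)%N (sg ^ 3)%N pair_loss => X1 X2 X3.
  rewrite natrD natrM [(8 * _)%:R]natrM natrX natrD natrM.
  by rewrite le_eqVlt; apply/orP; left; apply/eqP; ring.
have zM : #|Z|%:R <= M%:R :> R by rewrite ler_nat card_Z_le.
have ce := c2eps; set u := c2%:R * eps in ce hZ hY.
have u0 : 0 <= u by rewrite mulr_ge0 // ltW.
have L2 : 0 < L%:R ^+ 2 :> R by rewrite exprn_gt0.
have p0 : 0 <= pair_loss%:R * n%:R ^+ s :> R by rewrite mulr_ge0.
move: hZ hY ME' zM Q1 ce L2 p0; set X := pair_loss%:R * _.
move: (x a * x b) (gwt x Z) (gwt x Y) (#|Z|%:R) (M%:R) (L%:R ^+ 2) => ab gz gy z m l.
move=> hZ hY ME' zM Q1 ce l0 p0.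
have m0 : 0 <= 8 * l * (E1 + E2) by rewrite !mulr_ge0 ?addr_ge0 // ltW.
have k1 : gz - gy <= 2 * (u * m) + (E1 + E2).
  have := ler_wpM2l u0 zM; lra.
have k2 : 4 * l * (2 * (u * m) + (E1 + E2)) <= 2 * (m - X).
  have -> : 4 * l * (2 * (u * m) + (E1 + E2)) = (u * (8 * l)) * m + 4 * l * (E1 + E2) by ring.
  by rewrite ce; lra.
have k3 : 2 * (m - X) <= Q * l * (2 * (m - X)) by apply: ler_peMl => //; lra.
rewrite -(ler_pM2l (_ : 0 < 4 * l)) ?mulr_gt0 //.
have := ler_wpM2l (_ : 0 <= 4 * l) k1; rewrite mulr_ge0 ?(ltW l0) // => /(_ isT) k4.
apply: le_trans k4 (le_trans k2 _); apply: le_trans k3 _.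
by rewrite le_eqVlt; apply/orP; left; apply/eqP; field.
Qed.

Definition pair_ratio := (swap_ratio s pair_loss + pair_error)%N.

Lemma gwt_pair_case : (rho <= n)%N -> (1 < n)%N ->
  (pair_ratio * n ^ s <= M)%N -> gwt x G <= 'C(n, r)%:R.
Proof.
move=> rn n1; rewrite -(ler_nat R) natrM natrX /pair_ratio natrD => hM.
have N0 : 0 <= n%:R ^+ s :> R by rewrite exprn_ge0.
have a1 : 0 <= (swap_ratio s pair_loss)%:R * n%:R ^+ s :> R by rewrite mulr_ge0.
have a2 : 0 <= pair_error%:R * n%:R ^+ s :> R by rewrite mulr_ge0.
have h : gwt x Z - gwt x Y <= Q / 2 * (M%:R - pair_loss%:R * n%:R ^+ s).
  case: (leP (Q * L%:R ^+ 2) 1) => [h|/ltW h].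
    by apply: pair_small => //; lra.
  by apply: pair_large => //; lra.
rewrite gwt_pair_split; have := elsym_merged_le rn; lra.
Qed.

End Large.

End LightestPair.

(** * Induction on the support *)

Section Induction.
Variables (R : realFieldType) (T : finType) (s n : nat).
Let r := s.+3.
Let m := ('C(n, r) + 'C(n.-1, s.+2))%N.
Implicit Types (x : T -> R) (A e : {set T}) (G H : {set {set T}}).

Lemma gwt_scale x G (c : R) j : (forall e, e \in G -> #|e| = j) ->
  gwt (fun i => c * x i) G = c ^+ j * gwt x G.
Proof.
move=> Gj; rewrite /gwt mulr_sumr; apply: eq_bigr => e /Gj <-.
by rewrite /mon big_split /= prodr_const.
Qed.

Lemma mon_out x e i : i \in e -> x i = 0 -> mon x e = 0.
Proof. by move=> ie xi; rewrite (mon_setD1 x ie) xi mul0r. Qed.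

(** The exchange property follows from maximality, since replacing an edge e by a missing set f
    preserves the number of edges. *)
Lemma exists_optimal x A (k : nat) : exists2 G : {set {set T}},
  (G \subset draws A r) && (#|G| <= k)%N &
  (forall H, H \subset draws A r -> (#|H| <= k)%N -> gwt x H <= gwt x G) /\
  (forall e f, e \in G -> f \in draws A r :\: G -> mon x f <= mon x e).
Proof.
pose P H := (H \subset draws A r) && (#|H| <= k)%N.
have P0 : P set0 by rewrite /P sub0set cards0.
case: (arg_maxP (gwt x) P0) => G PG Gmax; exists G => //.
have opt H : H \subset draws A r -> (#|H| <= k)%N -> gwt x H <= gwt x G.
  by move=> HA Hk; apply: Gmax; apply/andP.
split=> // e f eG; rewrite in_setD => /andP[fG fA]; case/andP: PG => GA Gk.
have fGe : f \notin G :\ e by apply: contra fG; rewrite in_setD1 => /andP[].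
have := opt (f |: (G :\ e)).
rewrite subUset sub1set fA (subset_trans (subsetDl _ _) GA) => /(_ isT).
rewrite cardsU1 fGe /= add1n => /(_ _).
have -> : (#|G :\ e|.+1 = #|G|)%N by rewrite (cardsD1 e G) eG.
move=> /(_ Gk); rewrite /gwt big_setU1 //= [leRHS](big_setD1 e eG) /=.
by rewrite lerD2r.
Qed.

Hypothesis n_support : (support_bound s < n)%N.
Hypothesis n_small :
  (r ^ 2 * (2 * s.+1 * bin_ratio s.+1 * 2 ^ s.+1) ^ 2 <= n)%N.
Hypothesis n_var : (2 * var_bound s + 2 <= n)%N.
Hypothesis n_pair : (pair_ratio s (var_bound s) (r ^ 2) * n ^ s <= 'C(n.-1, s.+1))%N.
Hypothesis n_r : (2 * r ^ 2 <= n)%N.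
Hypothesis n_T : (n <= #|T|)%N.

Let n_gt1 : (1 < n)%N.
Proof. by apply: leq_trans n_var; rewrite addn2. Qed.

Let n_gt0 : 0 < n%:R :> R.
Proof. by rewrite ltr0n ltnW. Qed.

Let m_le : (m <= 'C(n.+1, r))%N.
Proof.
have -> : 'C(n.+1, r) = ('C(n, r) + 'C(n, s.+2))%N by exact: binS.
by rewrite leq_add2l leq_bin2l // leq_pred.
Qed.

Lemma critical_false x A G : critical n r x A G -> (#|G| <= m)%N ->
  (forall e f, e \in G -> f \in draws A r :\: G -> mon x f <= mon x e) -> False.
Proof.
move=> crit Gm opt.
have cG := leq_trans Gm m_le.
have xK := crit_bounded n_r crit.
have x0 := crit_ge0 crit.
have := crit_gt crit; apply/negP; rewrite -leNgt.
have An := crit_support n_support crit cG.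
case: (ltnP n #|A|) => An'; last first.
  (* Enlarge the support by vertices of weight zero to exactly n vertices. *)
  have [|p [Ap pT pn]] := @exists_between T A setT n (subsetT _).
    by rewrite An' cardsT.
  apply: (@le_trans _ _ (elsym x p r)).
    rewrite elsym_gwt; apply: gwt_le => //; apply: subset_trans (crit_unif crit) _.
    by apply/subsetP => e; rewrite !in_set => /andP[eA ->]; rewrite (subset_trans eA Ap).
  apply: elsym_bounded_le n_small _ pn x0 xK _.
    by apply: leq_trans n_r; rewrite leq_mul2l /= expnS expn1 leq_pmull.
  rewrite -(crit_sum crit) [LHS](big_setID A) /= (setIidPr Ap) -[RHS]addr0; congr (_ + _).
  by apply: big1 => i; rewrite in_setD => /andP[iA _]; rewrite (crit_out crit).
have cA : #|A| = n.+1 by apply/eqP; rewrite eqn_leq An.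
have /set0Pn[i0 i0A] : A != set0 by rewrite -card_gt0 cA.
case: (@arg_minP _ R _ i0 (fun i => i \in A) x i0A) => b bA b_min.
have /set0Pn[i1 i1A] : A :\ b != set0.
  rewrite -card_gt0; have := cardsD1 b A; rewrite bA cA add1n => -[<-].
  exact: ltnW.
case: (@arg_minP _ R _ i1 (fun i => i \in A :\ b) x i1A) => a; rewrite in_setD1 => /andP[aNb aA] a_min.
apply: (gwt_pair_case x0 cA (crit_sum crit) (ltnW n_gt1) aA bA aNb _ _ (crit_unif crit) Gm
  (crit_variance n_support crit cG) opt xK n_var n_gt1 n_pair).
  by move=> i iA; apply: b_min.
by move=> i iA ib; apply: a_min; rewrite in_setD1 ib.
Qed.

Lemma gwt_le_bin x G : (forall i, 0 <= x i) -> \sum_i x i = n%:R ->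
  (forall e, e \in G -> #|e| = r) -> (#|G| <= m)%N -> gwt x G <= 'C(n, r)%:R.
Proof.
move: {2}(#|_|) (leqnn #|[set i | x i != 0]|) => k.
elim: k x G => [|k IH] x G xk x0 x1 Gr Gm.
  have xz i : x i = 0.
    move: xk; rewrite leqn0 cards_eq0 => /eqP/setP/(_ i); rewrite in_set in_set0.
    by move/eqP.
  by move: n_gt0; rewrite -x1 big1 ?ltxx.
pose A := [set i | x i != 0].
have xout i : i \notin A -> x i = 0 by rewrite in_set negbK => /eqP.
have xA i : i \in A -> 0 < x i by rewrite in_set lt0r x0 andbT.
(* The induction hypothesis in homogeneous form, for an arbitrary total weight t. *)
have IHs (y : T -> R) H (t : R) : (#|[set i | y i != 0%R]| <= k)%N -> (forall i, 0 <= y i) ->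
    \sum_i y i = t -> (forall e, e \in H -> #|e| = r) -> (#|H| <= m)%N ->
    gwt y H <= 'C(n, r)%:R * (t / n%:R) ^+ r.
  move=> yk y0 y1 Hr Hm.
  have t0 : 0 <= t by rewrite -y1 sumr_ge0.
  case: (eqVneq t 0) => [tz|tnz].
    have yz i : y i = 0.
      apply/eqP; rewrite eq_le y0 andbT -tz -y1 (bigD1 i) //= lerDl.
      exact: sumr_ge0.
    rewrite /gwt big1; first by rewrite mulr_ge0 ?exprn_ge0 ?divr_ge0.
    move=> e /Hr er.
    have /set0Pn[i ie] : e != set0 by rewrite -card_gt0 er.
    exact: mon_out ie (yz i).
  have tp : 0 < t by rewrite lt0r tnz.
  have c0 : 0 < n%:R / t by rewrite divr_gt0.
  have := IH (fun i => n%:R / t * y i) H.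
  rewrite (gwt_scale _ _ Hr) -mulr_sumr y1 divfK // => h.
  rewrite -(ler_pM2l (exprn_gt0 r c0)); apply: le_trans (h _ _ _ Hr Hm) _ => //.
  - apply: leq_trans yk; apply: subset_leq_card; apply/subsetP => i; rewrite !in_set.
    by apply: contraNneq => ->; rewrite mulr0.
  - by move=> i; rewrite mulr_ge0 // ltW.
  rewrite mulrCA -exprMn; have -> : n%:R / t * (t / n%:R) = 1.
    by rewrite mulrA divfK // divff // gt_eqF.
  by rewrite expr1n mulr1.
rewrite leNgt; apply/negP => Ggt.
(* Pass to an optimal family on the support: it weighs at least as much as G and has the exchange
   property. *)
have [G0 /andP[G0A G0m] [G0max G0opt]] := exists_optimal x A m.
have G0r e : e \in G0 -> #|e| = r by move=> /(subsetP G0A); rewrite in_set => /andP[_ /eqP].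
have GG0 : gwt x G <= gwt x G0.
  apply: le_trans (G0max (G :&: draws A r) (subsetIr _ _) _); last first.
    by apply: leq_trans Gm; rewrite subset_leq_card // subsetIl.
  rewrite (gwt_setD x (subsetIl G (draws A r))) gerDl /gwt big1 // => e.
  rewrite in_setD in_setI => /andP[eGA eG]; move: eGA; rewrite eG /= in_set (Gr _ eG) eqxx andbT.
  by move=> /subsetPn[i ie iA]; apply: mon_out ie (xout i iA).
apply: (@critical_false x A G0 _ G0m G0opt); split => //.
- rewrite -x1 [RHS](bigID (mem A)) /= [X in _ = _ + X]big1 ?addr0 //.
- exact: lt_le_trans Ggt GG0.
move=> v vA.
have xv := xA v vA.
(* Deleting v leaves total weight n - x v on a smaller support, which bounds the edges avoiding v;
   the link of v must supply the rest. *)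
pose y i := if i == v then 0 else x i.
have yE : \sum_(e in G0 | v \notin e) mon x e = gwt y G0.
  rewrite /gwt [RHS](bigID (fun e : {set T} => v \in e)) /= [X in _ = X + _]big1 ?add0r.
    by apply: eq_bigr => e /andP[_ ve]; apply: eq_mon => i ie; rewrite /y; case: eqP ve => // <-; rewrite ie.
  by move=> e /andP[_ ve]; apply: mon_out ve _; rewrite /y eqxx.
have := IHs y G0 (n%:R - x v) _ _ _ G0r G0m; rewrite -yE => h.
have {}h : \sum_(e in G0 | v \notin e) mon x e <= 'C(n, r)%:R * ((n%:R - x v) / n%:R) ^+ r.
  apply: h.
  - rewrite -ltnS; apply: leq_trans xk; apply: proper_card; apply/properP; split.
      by apply/subsetP => i; rewrite !in_set /y; case: (i == v) => //; rewrite eqxx.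
    by exists v => //; rewrite in_set /y eqxx eqxx.
  - by move=> i; rewrite /y; case: eqP.
  - rewrite -x1 (bigD1 v) //= [in RHS](bigD1 v) //= /y eqxx add0r [X in _ = X - _]addrC addrK.
    by apply: eq_bigr => i /negbTE ->.
have := lt_le_trans Ggt GG0; rewrite (gwt_link x G0 v).
move: h; have -> : (n%:R - x v) / n%:R = 1 - x v / n%:R by rewrite mulrBl divff // gt_eqF.
rewrite mulrBr mulr1; lra.
Qed.

End Induction.

Theorem finite_lagrangian s : exists n0 : nat, forall (n : nat) (R : realFieldType)
    (T : finType) (x : T -> R) (G : {set {set T}}),
  (n0 <= n)%N -> (n <= #|T|)%N -> (forall i, 0 <= x i) -> \sum_i x i = n%:R ->
  (forall e, e \in G -> #|e| = s.+3) -> (#|G| <= 'C(n, s.+3) + 'C(n.-1, s.+2))%N ->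
  gwt x G <= 'C(n, s.+3)%:R.
Proof.
pose c1 := (support_bound s).+1.
pose c2 := (s.+3 ^ 2 * (2 * s.+1 * bin_ratio s.+1 * 2 ^ s.+1) ^ 2)%N.
pose c3 := (2 * var_bound s + 2)%N.
pose c4 := pair_ratio s (var_bound s) (s.+3 ^ 2).
(* The factor with n^(s+1) <= [c5] ['C(n.-1, s.+1)], so that n >= [c4] [c5] yields the lower bound
   on M used in the pair case. *)
pose c5 := (2 ^ s.+1 * bin_ratio s.+1)%N.
pose c6 := (2 * s.+3 ^ 2)%N.
exists (c1 + c2 + c3 + c4 * c5 + c6)%N => n R T x G hn nT x0 x1 Gr Gm.
have [h1 h2 h3 h4 h6] : [/\ c1 <= n, c2 <= n, c3 <= n, c4 * c5 <= n & c6 <= n]%N.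
  by move: (c4 * c5)%N hn => c7; move: c1 c2 c3 c6 => *; split; lia.
apply: gwt_le_bin => //.
rewrite -/c4.
have c50 : (0 < c5)%N by rewrite muln_gt0 expn_gt0 muln_gt0 expn_gt0 fact_gt0.
rewrite -(leq_pmul2l c50).
have n2 : (2 * s.+1 <= n.-1)%N.
  have : (2 * s.+3 <= n)%N by apply: leq_trans h6; rewrite leq_mul2l /= expnS expn1 leq_pmull.
  by move=> h; clear -h; lia.
apply: (@leq_trans (n ^ s.+1)).
  rewrite mulnA [(c5 * c4)%N]mulnC expnS leq_mul2r h4 orbT //.
apply: (@leq_trans (2 ^ s.+1 * n.-1 ^ s.+1)).
  by rewrite -expnMn leq_exp2r //; clear -n2; lia.
by rewrite /c5 -mulnA leq_mul2l expn_le_bin ?orbT.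
Qed.

(** * Graphs on the natural numbers *)

From mathcomp Require Import finmap.
Local Open Scope fset_scope.
Local Open Scope ring_scope.

Section Transfer.
Variable N : nat.
Implicit Types (e : {fset nat}) (G : {fset {fset nat}}).

Definition ord_set e : {set 'I_N} := [set i : 'I_N | (i : nat) \in e]%SET.
Definition ord_graph G : {set {set 'I_N}} :=
  [set E in [seq ord_set e | e <- enum_fset G]]%SET.
Definition below e := forall k, k \in e -> (k < N)%N.

Lemma ord_set_inj e f : below e -> below f -> ord_set e = ord_set f -> e = f.
Proof.
move=> be bf E; apply/fsetP => k; apply/idP/idP => hk.
  have := hk; have kN := be k hk; move/setP/(_ (Ordinal kN)): E.
  by rewrite !in_set /= => ->.
have := hk; have kN := bf k hk; move/setP/(_ (Ordinal kN)): E.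
by rewrite !in_set /= => ->.
Qed.

Lemma big_ord_set (V : Type) (idx : V) (op : Monoid.com_law idx) (g : nat -> V) e :
  below e -> \big[op/idx]_(k <- e) g k = \big[op/idx]_(i in ord_set e) g i.
Proof.
move=> be.
have P : perm_eq e [seq k <- iota 0 N | k \in e].
  apply: uniq_perm; rewrite ?filter_uniq ?iota_uniq ?fset_uniq // => k.
  rewrite mem_filter mem_iota add0n /=; case: (boolP (k \in e)) => // /be ->.
  by [].
rewrite (perm_big _ P) big_filter /=.
transitivity (\big[op/idx]_(0 <= k < N | k \in e) g k).
  by rewrite /index_iota subn0.
by rewrite big_mkord; apply: eq_bigl => i; rewrite in_set.
Qed.

Lemma card_ord_set e : below e -> #|ord_set e| = #|` e|.
Proof. by move=> be; rewrite -sum1_card -(big_ord_set _ (fun=> 1%N) be) big_const_seq count_predT iter_addn_0 mul1n. Qed.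

Lemma ord_graph_uniq G : (forall e, e \in G -> below e) ->
  uniq [seq ord_set e | e <- enum_fset G].
Proof.
move=> bG; rewrite map_inj_in_uniq ?fset_uniq // => e f eG fG.
by apply: ord_set_inj; apply: bG.
Qed.

Lemma big_ord_graph (V : Type) (idx : V) (op : Monoid.com_law idx) (F : {set 'I_N} -> V) G :
  (forall e, e \in G -> below e) ->
  \big[op/idx]_(e <- G) F (ord_set e) = \big[op/idx]_(E in ord_graph G) F E.
Proof.
move=> bG; rewrite -(big_map ord_set xpredT F) (big_uniq _ (ord_graph_uniq bG)).
by apply: eq_bigl => E; rewrite in_set.
Qed.

Lemma card_ord_graph G : (forall e, e \in G -> below e) -> #|ord_graph G| = #|` G|.
Proof.
move=> bG; rewrite -sum1_card -(big_ord_graph _ (fun=> 1%N)) //.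
by rewrite big_const_seq count_predT iter_addn_0 mul1n.
Qed.

Lemma mem_ord_graph G E : E \in ord_graph G -> exists2 e, e \in G & E = ord_set e.
Proof. by rewrite in_set => /mapP. Qed.

End Transfer.

Lemma exists_below (G : {fset {fset nat}}) : exists N, forall e, e \in G -> below N e.
Proof.
exists (\max_(e <- G) \max_(k <- e) k)%N.+1 => e eG k ke; rewrite ltnS.
apply: (@leq_trans (\max_(k <- e) k)%N); first exact: (@leq_bigmax_seq _ _ xpredT id k ke).
exact: (@leq_bigmax_seq _ _ xpredT (fun e : {fset nat} => \max_(k <- e) k)%N e eG).
Qed.

Theorem fset_lagrangian s : exists n0 : nat, forall (n : nat) (R : realFieldType)
    (w : nat -> R) (G : {fset {fset nat}}),
  (n0 <= n)%N -> (forall k, 0 <= w k) -> (forall N, \sum_(0 <= k < N) w k <= 1) ->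
  (forall e, e \in G -> #|` e| = s.+3) ->
  (#|` G| <= 'C(n, s.+3) + 'C(n.-1, s.+2))%N ->
  n%:R ^+ s.+3 * (\sum_(e <- G) \prod_(k <- e) w k) <= 'C(n, s.+3)%:R.
Proof.
have [n0 H] := finite_lagrangian s; exists n0 => n R w G hn w0 w1 Gr Gm.
(* N exceeds n to provide enough vertices, and is a successor so that vertex 0 exists. *)
have [N' bG'] := exists_below G; pose N := (N' + n).+1.
have bG e : e \in G -> below N e.
  by move=> /bG' be k /be kN; rewrite /N ltnS (leq_trans (ltnW kN)) ?leq_addr.
have sN := w1 N; rewrite big_mkord in sN; set sg := \sum_(i < N) w i in sN.
(* The weight missing from the first N vertices is moved to vertex 0. *)
pose x (i : 'I_N) := n%:R * w i + (if i == ord0 then n%:R * (1 - sg) else 0).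
have d0 : 0 <= n%:R * (1 - sg) by rewrite mulr_ge0 // subr_ge0.
have x0 i : 0 <= x i by rewrite addr_ge0 ?mulr_ge0 //; case: ifP.
have x1 : \sum_i x i = n%:R.
  rewrite big_split /= -mulr_sumr -/sg -big_mkcond big_pred1_eq; ring.
have := H n R 'I_N x (ord_graph N G) hn _ x0 x1 _ _.
rewrite card_ord (leq_trans (leq_addl N' n)) // card_ord_graph // => h.
apply: le_trans (h _ _ _) => //; last first.
  by move=> E /mem_ord_graph[e eG ->]; rewrite card_ord_set ?Gr //; apply: bG.
rewrite mulr_sumr /gwt -big_ord_graph // big_seq [leRHS]big_seq; apply: ler_sum => e eG.
rewrite (big_ord_set _ _ (bG e eG)) /mon -(Gr e eG) -(card_ord_set (bG e eG)) -prodr_const -big_split /=.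
apply: ler_prod => i _; rewrite mulr_ge0 //= /x lerDl; case: ifP => //.
Qed.

(** * Lagrangians and the colex order *)

Require Import Defs.
From HB Require Import structures.
From mathcomp Require Import all_classical all_reals all_analysis.
Import Order.TTheory GRing.Theory Num.Theory numFieldNormedType.Exports.
Local Open Scope fset_scope.
Local Open Scope ring_scope.

Lemma weighting_sum_le1 (R : realType) (w : nat -> R) N :
  weighting w -> \sum_(0 <= k < N) w k <= 1.
Proof.
move=> [w0 w1]; rewrite -(cvg_lim (@Rhausdorff R) w1).
apply: (nondecreasing_cvgn_le (u_ := fun n => \sum_(0 <= k < n) w k)); last first.
  by apply/cvg_ex; exists 1.
apply/nondecreasing_seqP => k; rewrite big_nat_recr //= lerDl; exact: w0.
Qed.

Lemma weighting_le1 (R : realType) (w : nat -> R) k : weighting w -> w k <= 1.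
Proof.
move=> hw; apply: le_trans (weighting_sum_le1 k.+1 hw).
by rewrite big_nat_recr //= lerDr sumr_ge0 // => i _; case: hw.
Qed.

(** The bound #|G| makes [sup] a genuine upper bound rather than a default value. *)
Lemma wgraph_has_sup (R : realType) (G : {fset {fset nat}}) :
  has_ubound [set wgraph w G | w in [set w : nat -> R | weighting w]]%classic.
Proof.
exists (\sum_(e <- G) 1) => _ /= [w hw <-]; apply: ler_sum => e _.
rewrite -[leRHS](big1_eq (op := *%R) e xpredT); apply: ler_prod => k _.
by rewrite weighting_le1 // andbT; case: hw.
Qed.

Lemma mem_rsets n r (e : {fset nat}) :
  reflect (below n e /\ #|` e| = r) (e \in rsets n r).
Proof.
rewrite !inE fpowersetE /=; apply: (iffP andP) => -[h1 /eqP h2]; split=> //.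
  by move=> k /(fsubsetP h1); rewrite !inE mem_iota.
by apply/fsubsetP => k /h1; rewrite !inE mem_iota.
Qed.

Lemma card_rsets n r : #|` rsets n r| = 'C(n, r).
Proof.
have bG e : e \in rsets n r -> below n e by move=> /mem_rsets[].
rewrite -(card_ord_graph bG) -[in RHS](card_ord n) -cardsT -card_draws_set.
congr #|pred_of_set _|; apply/setP => E; apply/idP/idP.
  move=> /mem_ord_graph[e /mem_rsets[be er] ->].
  by rewrite finset.in_set finset.subsetT card_ord_set // er eqxx.
rewrite finset.in_set => /andP[_ /eqP Er].
pose e := [fset nat_of_ord i | i in E].
have be : below n e by move=> k /imfsetP[i _ ->]; exact: ltn_ord.
have eE : ord_set n e = E.
  apply/setP => i; rewrite finset.in_set; apply/imfsetP/idP => [[j jE /val_inj -> //]|iE].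
  by exists i.
rewrite finset.in_set -eE; apply/mapP; exists e => //; apply/mem_rsets; split => //.
by rewrite -(card_ord_set be) eE.
Qed.

Lemma colex_code_below n e : below n e -> (colex_code e < 2 ^ n)%N.
Proof.
move=> be; rewrite /colex_code (big_ord_set _ (fun i => 2 ^ i)%N be).
apply: (@leq_ltn_trans (\sum_(i < n) 2 ^ i)%N).
  by rewrite big_mkcond; apply: leq_sum => i _; case: ifP.
elim: n {be} => [|n IH]; first by rewrite big_ord0.
by rewrite big_ord_recr /= expnS mul2n -addnn -addSn leq_add2r.
Qed.

Lemma below_colex_code n e : (colex_code e < 2 ^ n)%N -> below n e.
Proof.
move=> h k ke; rewrite ltnNge; apply/negP => nk; move: h; apply/negP; rewrite -leqNgt.
rewrite /colex_code (big_fsetD1 k ke) /=; apply: leq_trans (leq_addr _ _).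
by rewrite leq_exp2l.
Qed.

(** Places the first n vertices inside the ambient range of size m + r used by [colex]. *)
Lemma leq_bin_add n r : (0 < r)%N -> (n <= 'C(n, r) + r)%N.
Proof.
move=> r0; elim: n => [//|n IH]; case: (ltnP n r) => nr.
  by apply: leq_trans nr (leq_addl _ _).
case: r r0 nr IH => // r _ nr IH; rewrite binS.
have : (0 < 'C(n, r))%N by rewrite bin_gt0 ltnW.
lia.
Qed.

(** Lying below n means having colex code less than 2^n, so all colex predecessors of e lie in
    [rsets n r] without e itself, and there are fewer than ['C(n, r)] of them. *)
Lemma rsets_sub_colex n m r : (0 < r)%N -> ('C(n, r) <= m)%N ->
  {subset rsets n r <= colex m r}.
Proof.
move=> r0 nm e en; have /mem_rsets[be er] := en.
have nmr : (n <= m + r)%N.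
  by apply: leq_trans (leq_bin_add n r0) _; rewrite leq_add2r.
rewrite !inE -andbA; apply/and3P; split.
- by rewrite fpowersetE; apply/fsubsetP => k /be kn; rewrite !inE mem_iota /= (leq_trans kn).
- by rewrite er.
apply: leq_trans nm; rewrite -card_rsets [ltnRHS](cardfsD1 e) en add1n ltnS.
apply: fsubset_leq_card; apply/fsubsetP => f fB.
have /andP[/mem_rsets[_ fr] fe] :
    (f \in rsets (m + r) r) && (colex_code f < colex_code e)%N by move: fB; rewrite !inE.
rewrite !in_fsetD1; apply/andP; split; first by apply: contraTneq fe => ->; rewrite ltnn.
apply/mem_rsets; split => //; apply: below_colex_code.
exact: ltn_trans fe (colex_code_below be).
Qed.

(** * The uniform weighting and the final comparison *)

Definition uniform (R : realType) n (k : nat) : R := if (k < n)%N then n%:R^-1 else 0.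

Lemma weighting_uniform (R : realType) n : (0 < n)%N -> weighting (@uniform R n).
Proof.
move=> n0; split=> [k|]; first by rewrite /uniform; case: ifP.
apply: cvg_near_cst; exists n => // N /= nN.
rewrite (big_cat_nat (leq0n n) nN) /= [X in _ + X]big1_seq ?addr0; last first.
  by move=> k; rewrite mem_index_iota => /andP[_ /andP[nk _]]; rewrite /uniform ltnNge nk.
rewrite (eq_big_nat _ _ (F2 := fun=> n%:R^-1)); last first.
  by move=> k /andP[_ kn]; rewrite /uniform kn.
by rewrite sumr_const_nat subn0 -[_ *+ n]mulr_natr mulVf // pnatr_eq0 -lt0n.
Qed.

Lemma lagrangian_colex_ge (R : realType) n m r : (0 < r)%N -> (0 < n)%N -> ('C(n, r) <= m)%N ->
  'C(n, r)%:R / n%:R ^+ r <= lagrangian R (colex m r).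
Proof.
move=> r0 n0 nm; have hw := weighting_uniform R n0; set w := @uniform R n in hw.
apply: le_trans (ub_le_sup (wgraph_has_sup R (colex m r)) _); last by exists w.
have sub := rsets_sub_colex r0 nm.
have P : perm_eq [seq e <- colex m r | e \in rsets n r] (rsets n r).
  apply: uniq_perm; rewrite ?filter_uniq ?fset_uniq // => e; rewrite mem_filter.
  by case: (boolP (e \in rsets n r)) => //= /sub ->.
rewrite /wgraph (bigID (fun e => e \in rsets n r)) /= -big_filter (perm_big _ P) /=.
apply: (@le_trans _ _ (\sum_(e <- rsets n r) wedge w e)); last first.
  by rewrite lerDl sumr_ge0 // => e _; apply: prodr_ge0 => k _; case: hw.
rewrite (eq_big_seq (fun=> n%:R^-1 ^+ r)) /=; last first.
  move=> e /mem_rsets[be er]; rewrite /wedge (eq_big_seq (fun=> n%:R^-1)) /=.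
    by rewrite big_const_seq count_predT iter_mulr_1 er.
  by move=> k /be kn; rewrite /w /uniform kn.
by rewrite big_const_seq count_predT iter_addr_0 card_rsets exprVn mulr_natl.
Qed.

Theorem theorem1p2 (r : nat) (hr : (3 <= r)%N) :
  exists t0 : nat, forall (t m : nat), (t0 <= t)%N ->
    ('C(t.-1, r) <= m)%N -> (m <= 'C(t, r) - 'C(t - 2, r - 2))%N ->
    forall (R : realType) (G : {fset {fset nat}}),
      is_rgraph r G -> #|` G| = m ->
      lagrangian R G <= lagrangian R (colex m r).
Proof.
case: r hr => [|[|[|s]]] // _; have [n0 H] := fset_lagrangian s.
exists (n0 + 3)%N => t m ht lo hi R G Gr Gm.
have [n0n n1] : (n0 <= t.-1)%N /\ (1 < t.-1)%N by split; lia.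
apply: le_trans (@lagrangian_colex_ge R t.-1 m s.+3 isT (ltnW n1) lo).
(* With n = t - 1, Pascal's rule applied twice turns ['C(t, r) - 'C(t - 2, r - 2)] into ['C(n, r)] +
   ['C(n.-1, r.-1)]. *)
have cG : (#|` G| <= 'C(t.-1, s.+3) + 'C(t.-1.-1, s.+2))%N.
  rewrite Gm; apply: leq_trans hi _.
  have -> : t = t.-1.-1.+2 by lia.
  rewrite /= !subSS !subn0 binS [X in (_ + X - _)%N]binS; lia.
apply: ge_sup.
  (* [ge_sup] requires a nonempty set of values; the uniform weighting supplies one. *)
  exists (wgraph (@uniform R t.-1) G); exists (@uniform R t.-1) => //.
  exact: weighting_uniform (ltnW n1).
move=> _ /= [w hw <-].
have p : 0 < t.-1%:R ^+ s.+3 :> R by rewrite exprn_gt0 // ltr0n ltnW.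
rewrite ler_pdivlMr // mulrC; apply: H => //.
  by case: hw.
by move=> N; exact: weighting_sum_le1.
Qed.
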